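(* Let $a_1,\dots,a_n>0$, $\psi_1,\dots,\psi_n\in\mathbb{R}$, $E>1$ and $\alpha\geq0$ be constants. For $j=1,\dots,n$ define $r_j:\mathbb{R}\to\mathbb{R}$ by $r_j(s)=\sqrt{\frac{1}{a_j}+s^2}$ and $\phi_j:\mathbb{R}\to\mathbb{R}$ by $$\phi_j(s)=\psi_j+\int_0^s\frac{|t|}{\big(\frac{1}{a_j}+t^2\big)\sqrt{E\{\prod_{k=1}^n(1+a_kt^2)\}e^{\alpha t^2}-1}}\,dt.$$ Then the submanifold $L$ in $\mathbb{C}^n$ given by $$L=\Big\{(x_1r_1(s)e^{i\phi_1(s)},\dots,x_nr_n(s)e^{i\phi_n(s)})\ :\ \sum_{j=1}^nx_j^2=1,\ x_j\in\mathbb{R},\ s\in\mathbb{R},\ s\neq0\Big\}$$ is an immersed Lagrangian submanifold diffeomorphic to $(\mathbb{R}\setminus\{0\})\times S^{n-1}$, and its position vector $F$ and mean curvature vector $H$ satisfy $H\equiv\alpha F^{\perp}$.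
   Context: $\mathbb{C}^n\cong\mathbb{R}^{2n}$ carries its standard Euclidean metric, complex structure $J$ (multiplication by $i$) and symplectic form. $L$ is regarded as an immersed submanifold via the parametrization $((x_1,\dots,x_n),s)\mapsto(x_1r_1(s)e^{i\phi_1(s)},\dots,x_nr_n(s)e^{i\phi_n(s)})$ defined for $x\in S^{n-1}\subset\mathbb{R}^n$ and $s\in\mathbb{R}\setminus\{0\}$; ''diffeomorphic to'' refers to the domain of this immersion. $F$ is the position vector of $L$ in $\mathbb{C}^n$, $F^{\perp}$ is its orthogonal projection to the normal bundle of $L$, and $H$ is the mean curvature vector of $L$ (the trace of the second fundamental form). *)

(* Defs.v *)
From HB Require Import structures.
From mathcomp Require Import all_boot all_order all_algebra.
From mathcomp Require Import all_classical all_reals all_analysis.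
Set Implicit Arguments.
Unset Strict Implicit.
Unset Printing Implicit Defensive.
Import Order.TTheory GRing.Theory Num.Theory.
Import numFieldNormedType.Exports.
Local Open Scope classical_set_scope.
Local Open Scope ring_scope.

Section Smooth.
Variable R : realType.

(* [f] is k times continuously (Frechet) differentiable on the open set [U].
   For a finite-dimensional [V], continuity of x |-> 'd f x amounts to
   continuity of every x |-> 'd f x v = 'D_v f x. *)
Fixpoint Ck (V W : normedModType R) (k : nat) (U : set V) (f : V -> W) : Prop :=
  match k with
  | 0 => forall x, U x -> {for x, continuous f}
  | k'.+1 => (forall x, U x -> differentiable f x) /\
             (forall v, Ck k' U ('D_v f))
  end.

Definition smooth_on (V W : normedModType R) (U : set V) (f : V -> W) : Prop :=
  forall k, Ck k U f.

(* A smooth parametrization of a relatively open part of [M], a subset of [V],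
   by an open subset [U] of R^m: an immersion of [U] which is a homeomorphism
   onto its image. *)
Definition local_param (V : normedModType R) (m : nat) (M : set V)
    (U : set 'rV[R]_m) (kappa : 'rV[R]_m -> V) : Prop :=
  [/\ open U,
      smooth_on U kappa,
      forall u, U u -> injective ('d kappa u),
      exists2 O : set V, open O & kappa @` U = M `&` O
    & exists2 g : V -> 'rV[R]_m, {within kappa @` U, continuous g} &
        forall u, U u -> g (kappa u) = u].

Definition submanifold (V : normedModType R) (m : nat) (M : set V) : Prop :=
  forall p, M p -> exists U (kappa : 'rV[R]_m -> V),
    local_param M U kappa /\ (kappa @` U) p.

(* Maps on [M] are represented by functions on the ambient space, of which only
   the values on [M] matter. *)
Definition smooth_map (V W : normedModType R) (m : nat) (M : set V)
    (f : V -> W) : Prop :=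
  forall U (kappa : 'rV[R]_m -> V), local_param M U kappa ->
    smooth_on U (f \o kappa).

Definition diffeomorphic (V W : normedModType R) (m : nat)
    (M : set V) (N : set W) : Prop :=
  [/\ submanifold m M, submanifold m N
    & exists (f : V -> W) (g : W -> V),
        [/\ smooth_map m M f, smooth_map m N g,
            forall p, M p -> N (f p) /\ g (f p) = p
          & forall q, N q -> M (g q) /\ f (g q) = q]].

Definition immersion (V W : normedModType R) (m : nat) (M : set V)
    (F : V -> W) : Prop :=
  smooth_map m M F /\
  forall U (kappa : 'rV[R]_m -> V), local_param M U kappa ->
    forall u, U u -> injective ('d (F \o kappa) u).

Definition immersed_submanifold (V W : normedModType R) (m : nat) (M : set V)
    (F : V -> W) (L : set W) : Prop :=
  [/\ submanifold m M, immersion m M F & L = F @` M].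

End Smooth.

Section Extrinsic.
Variables (R : realType) (m N : nat).

Definition dot (u v : 'rV[R]_N) : R := \sum_i u 0 i * v 0 i.

(* The orthogonal projection of [w] to the orthogonal complement of the row
   space of [A]; [kermx A^T] spans the vectors orthogonal to the rows of [A]. *)
Definition normal_part (A : 'M[R]_(m, N)) (w : 'rV[R]_N) : 'rV[R]_N :=
  w *m proj_mx (kermx A^T) <<A>>%MS.

Implicit Types (X : 'rV[R]_m -> 'rV[R]_N) (u : 'rV[R]_m).

Definition partial (W : normedModType R) (i : 'I_m) (X : 'rV[R]_m -> W) :
  'rV[R]_m -> W := 'D_(delta_mx 0 i) X.

(* Below, [X] is an immersion expressed in local coordinates; the tangent space
   at [u] is the row space of the Jacobian ['J X u], whose rows are the
   [partial i X u]. *)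
Definition metric X u : 'M[R]_m :=
  \matrix_(i, j) dot (partial i X u) (partial j X u).

Definition second_form X u (i j : 'I_m) : 'rV[R]_N :=
  normal_part ('J X u) (partial i (partial j X) u).

Definition mean_curvature X u : 'rV[R]_N :=
  \sum_i \sum_j (invmx (metric X u)) i j *: second_form X u i j.

End Extrinsic.

Section Symplectic.
Variables (R : realType) (n : nat).

(* C^n is identified with R^(2n): the real parts come first, then the imaginary
   parts. *)
Definition Jmul (z : 'rV[R]_(n + n)) : 'rV[R]_(n + n) :=
  row_mx (- rsubmx z) (lsubmx z).

Definition omega (z w : 'rV[R]_(n + n)) : R := dot (Jmul z) w.

(* Only isotropy is stated here: the dimension of [M] is half that of C^n. *)
Definition lagrangian (V : normedModType R) (M : set V)
    (F : V -> 'rV[R]_(n + n)) : Prop :=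
  forall U (kappa : 'rV[R]_n -> V), local_param M U kappa ->
    forall u, U u -> forall v w,
      omega ('d (F \o kappa) u v) ('d (F \o kappa) u w) = 0.

End Symplectic.

Section Construction.
Variable R : realType.

Definition oriented_integral (f : R -> R) (b c : R) : R :=
  if b <= c then \int[lebesgue_measure]_(t in `[b, c]) f t
  else - \int[lebesgue_measure]_(t in `[c, b]) f t.

Definition sphere (n : nat) : set 'rV[R]_n :=
  [set x | \sum_j x 0 j ^+ 2 = 1].

Definition nonzero : set R := [set s | s != 0].

Variables (n : nat) (a psi : 'I_n -> R) (E alpha : R).

Definition rad (j : 'I_n) (s : R) : R := Num.sqrt ((a j)^-1 + s ^+ 2).

Definition phase (j : 'I_n) (s : R) : R :=
  psi j + oriented_integral (fun t => `|t| /
    (((a j)^-1 + t ^+ 2) *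
     Num.sqrt (E * (\prod_k (1 + a k * t ^+ 2)) * expR (alpha * t ^+ 2) - 1)))
    0 s.

(* The j-th complex coordinate is x_j * r_j(s) * e^(i * phi_j(s)). *)
Definition Lpoint (x : 'rV[R]_n) (s : R) : 'rV[R]_(n + n) :=
  row_mx (\row_j (x 0 j * rad j s * cos (phase j s)))
         (\row_j (x 0 j * rad j s * sin (phase j s))).

Definition Lset : set 'rV[R]_(n + n) :=
  [set z | exists (x : 'rV[R]_n) (s : R),
    [/\ \sum_j x 0 j ^+ 2 = 1, s != 0 & z = Lpoint x s]].

Definition Lparam (p : 'rV[R]_n * R) : 'rV[R]_(n + n) := Lpoint p.1 p.2.

Definition Ldomain : set ('rV[R]_n * R) := @sphere n `*` nonzero.

End Construction.

Arguments sphere R n : clear implicits.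
Arguments nonzero R : clear implicits.
Arguments Ldomain R n : clear implicits.

(* Main.v *)
Require Import Defs.
From HB Require Import structures.
From mathcomp Require Import all_boot all_order all_algebra.
From mathcomp Require Import all_classical all_reals all_analysis.
From mathcomp Require Import ring.
Import Order.TTheory GRing.Theory Num.Theory.
Import numFieldNormedType.Exports.
Local Open Scope classical_set_scope.
Local Open Scope ring_scope.
Set Implicit Arguments.
Unset Strict Implicit.
Unset Printing Implicit Defensive.

(** Write [w_j = r_j * e^(i * phi_j)], so that the immersion is
    [(x, s) |-> (x_j * w_j(s))_j]. Since [r_j * r_j' = s], and since
    [r_j ^ 2 * phi_j'] is a function [Lambda] of [s] which does not depend on j
    ([slope], [is_derive_phase]), the number [q = s + i * Lambda] satisfies
    [w_j' = e^(i * phi_j) * q / r_j] and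
    [w_j'' = e^(i * phi_j) * (q' / r_j - |q| ^ 2 / r_j ^ 3)]. The rotation
    [e^(i * phi_j)] disappears from all scalar products and symplectic products
    in the j-th complex coordinate, which makes them explicit rational
    expressions. All the pointwise statements are computed for tangent vectors
    [(xi, sigma)] of the cylinder [S^(n-1) * R], i.e. with [x . xi = 0]
    ([sphere_tangent]).

    - Immersion ([push_inj]): the imaginary part of the rotated differential is
      [x_j * sigma * Lambda / r_j], which forces [sigma = 0] because some
      [x_j] is nonzero and [Lambda <> 0] for [s <> 0]; then [xi = 0].
    - Lagrangian ([omega_push]): the symplectic product of the images of
      [(xi, sigma)] and [(eta, tau)] is
      [Lambda * (tau * (x . xi) - sigma * (x . eta)) = 0].
    - Mean curvature. The normal space is the image of the tangent space under
      [J], so that a vector whose symplectic products with the tangent vectors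
      vanish is tangent ([lagrangian_maximal]). It is therefore enough to
      compare the symplectic products of [sum g^(ij) d_i d_j F] and of
      [alpha * F] with tangent vectors. The induced metric is the restriction
      to the tangent space of the diagonal form with entries [r_j ^ 2] and
      [|q| ^ 2 * A], where [A = sum x_j ^ 2 / r_j ^ 2]; adding to the
      frame the vector [(x_j / r_j ^ 2, 0)], which is orthogonal to the tangent
      space for that form, yields the contractions of the inverse metric with
      the frame ([inverse_metric]). The trace then reduces to
      [- (Lambda * sum r_j^(-2) + (s * Lambda' - Lambda) / |q| ^ 2)] times the
      last component of the tangent vector, and the formula for [Lambda] says
      precisely that this factor equals [alpha * Lambda] ([is_derive_slope],
      [trace_omega]), which is what [alpha * F] gives.

    Smoothness in the sense of iterated differentiability is obtained from
    closure under sums, products and composition with functions of one variable,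
    and the cylinder is covered by the graph charts over the coordinate
    hyperplanes ([chart]). *)

(** * Calculus of smooth maps *)

Section SmoothCalculus.
Variable R : realType.
Implicit Types V W : normedModType R.

(** Derivatives, differentiability and [Ck] on an open set only depend on the
    restriction of the map to that set. *)
Lemma derive_eq_on V W (U : set V) (f g : V -> W) x v :
  open U -> (forall y, U y -> f y = g y) -> U x -> 'D_v f x = 'D_v g x.
Proof.
move=> oU fg Ux; apply: near_eq_derive.
have : nbhs x U by exact: open_nbhs_nbhs.
by apply: filterS => y /fg.
Qed.

Lemma differentiable_eq_on V W (U : set V) (f g : V -> W) x :
  open U -> (forall y, U y -> f y = g y) -> U x ->
  differentiable f x -> differentiable g x.
Proof.
move=> oU fg Ux df.
have Unx : nbhs x U by exact: open_nbhs_nbhs.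
have [cf fE] := (diff_locallyP x f).1 df.
have gE : g \o shift x = cst (g x) + 'd f x +o_ 0 id.
  move/eqaddoP: fE => fE; apply/eqaddoP => e e0.
  have := fE e e0.
  have : \forall h \near (0 : V), U (h + x).
    have := (nbhs0P U x).1 Unx; apply: filterS => h.
    by rewrite addrC.
  move=> U0 fe; near=> h.
  suff -> : (g \o shift x - (cst (g x) + 'd f x)) h =
            (f \o shift x - (cst (f x) + 'd f x)) h by near: h.
  by rewrite !fctE /= !fg//; near: h.
by apply/diff_locallyP; rewrite (diff_unique cf gE).
Unshelve. all: by end_near. Qed.

Lemma Ck_eq V W k (U : set V) (f g : V -> W) :
  open U -> (forall y, U y -> f y = g y) -> Ck k U f -> Ck k U g.
Proof.
move=> oU; elim: k f g => [|k IH] f g fg /=.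
  move=> cf x Ux; have Unx : nbhs x U by exact: open_nbhs_nbhs.
  have : f @ x --> f x by exact: (cf x Ux).
  rewrite (fg _ Ux); apply: cvg_trans; apply: near_eq_cvg.
  by apply: filterS Unx => y Uy; rewrite fg.
move=> [df dfk]; split => [x Ux|v].
  exact: (differentiable_eq_on oU fg Ux (df x Ux)).
apply: (IH ('D_v f)); last exact: dfk.
by move=> y Uy; exact: (derive_eq_on _ oU fg Uy).
Qed.

Lemma Ck_continuous V W k (U : set V) (f : V -> W) :
  Ck k U f -> forall x, U x -> {for x, continuous f}.
Proof. by case: k => [//|k] [df _] x Ux; exact/differentiable_continuous/df. Qed.

Lemma CkS V W k (U : set V) (f : V -> W) : Ck k.+1 U f -> Ck k U f.
Proof.
elim: k f => [|k IH] f; first exact: (@Ck_continuous _ _ 1).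
by move=> [df dfk]; split => // v; apply: IH; exact: dfk.
Qed.

Lemma Ck_cst V W k (U : set V) (c : W) : Ck k U (cst c : V -> W).
Proof.
elim: k c => [|k IH] c /=; first by move=> x _; exact: cst_continuous.
split=> [x _|v]; first exact: differentiable_cst.
by rewrite (_ : 'D_v _ = cst 0)//; apply/funext => x; rewrite derive_cst.
Qed.

Lemma Ck_add V W k (U : set V) (f g : V -> W) : open U ->
  Ck k U f -> Ck k U g -> Ck k U (fun x => f x + g x).
Proof.
move=> oU; elim: k f g => [|k IH] f g /=.
  by move=> cf cg x Ux; apply: continuousD; [exact: cf|exact: cg].
move=> [df dfk] [dg dgk]; split=> [x Ux|v].
  by apply: differentiableD; [exact: df|exact: dg].
apply: (@Ck_eq _ _ _ _ (fun x => 'D_v f x + 'D_v g x)) => //; last exact: IH.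
by move=> y Uy; rewrite deriveD//; apply: diff_derivable; [exact: df|exact: dg].
Qed.

Lemma Ck_sum V W k (U : set V) n (f : 'I_n -> V -> W) : open U ->
  (forall i, Ck k U (f i)) -> Ck k U (fun x => \sum_i f i x).
Proof.
move=> oU; elim: n f => [|n IH] f fk.
  by apply: Ck_eq (Ck_cst k U 0) => // y _; rewrite big_ord0.
apply: (@Ck_eq _ _ _ _ (fun x => f ord0 x + \sum_i f (lift ord0 i) x)) => //.
  by move=> y _; rewrite big_ord_recl.
by apply: Ck_add => //; exact: IH.
Qed.

Lemma derive_comp V W1 W2 (f : V -> W1) (g : W1 -> W2) x v :
  differentiable f x -> differentiable g (f x) ->
  'D_v (g \o f) x = 'd g (f x) ('D_v f x).
Proof.
move=> df dg; rewrite deriveE; last exact: differentiable_comp.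
by rewrite (diff_comp df dg) /= deriveE.
Qed.

Lemma Ck_linear V W1 W2 k (U : set V) (l : {linear W1 -> W2}) (f : V -> W1) :
  open U -> continuous l -> Ck k U f -> Ck k U (l \o f).
Proof.
move=> oU lc; elim: k f => [|k IH] f /=.
  by move=> cf x Ux; apply: continuous_comp; [exact: cf|exact: lc].
move=> [df dfk]; split=> [x Ux|v].
  by apply: differentiable_comp; [exact: df|exact: linear_differentiable].
apply: (@Ck_eq _ _ _ _ (l \o 'D_v f)) => //; last exact: IH.
move=> y Uy /=; have dl := linear_differentiable (f y) lc.
have dfy := df _ Uy.
by rewrite derive_comp// diff_lin.
Qed.

Lemma Ck_mul V k (U : set V) (f g : V -> R) : open U ->
  Ck k U f -> Ck k U g -> Ck k U (fun x => f x * g x).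
Proof.
move=> oU; elim: k f g => [|k IH] f g /=.
  by move=> cf cg x Ux; apply: continuousM; [exact: cf|exact: cg].
move=> fk1 gk1; have [df dfk] := fk1; have [dg dgk] := gk1.
split=> [x Ux|v]; first by apply: differentiableM; [exact: df|exact: dg].
apply: (@Ck_eq _ _ _ _ (fun x => f x * 'D_v g x + g x * 'D_v f x)) => //.
  by move=> y Uy; rewrite deriveM//; apply: diff_derivable; [exact: df|exact: dg].
by apply: Ck_add => //; apply: IH => //; apply: CkS.
Qed.

(** Chain rule for the composition with a function of one variable. *)
Lemma differentiable_comp1 V (f : V -> R) (g : R -> R) (d : R) x v :
  differentiable f x -> is_derive (f x) 1 g d ->
  differentiable (g \o f) x /\ 'D_v (g \o f) x = d * 'D_v f x.
Proof.
move=> df [/derivable1_diffP dg gE].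
have dgf : differentiable (g \o f) x by exact: differentiable_comp.
split=> //; rewrite derive_comp//.
have -> : 'd g (f x) ('D_v f x) = 'D_v f x *: 'd g (f x) 1.
  by rewrite -linearZ /= [_ *: 1]mulr1.
by rewrite -deriveE// gE mulrC.
Qed.

Lemma Ck_comp1 V k (U : set V) (O : set R) (f : V -> R) (g : R -> R) :
  open U -> (forall x, U x -> O (f x)) -> Ck k O g -> Ck k U f ->
  Ck k U (g \o f).
Proof.
move=> oU UO; elim: k f g UO => [|k IH] f g UO.
  move=> cg cf x Ux; apply: continuous_comp; first exact: cf.
  by apply: cg; exact: UO.
move=> gk1 fk1; have [dg dgk] := gk1; have [df dfk] := fk1.
have H x v : U x -> differentiable (g \o f) x /\
    'D_v (g \o f) x = ('D_1 g \o f) x * 'D_v f x.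
  move=> Ux; apply: differentiable_comp1; first exact: df.
  by apply/derivableP/derivable1_diffP/dg/UO.
split=> [x Ux|v]; first by have [] := H x 0 Ux.
apply: (@Ck_eq _ _ _ _ (fun x => ('D_1 g \o f) x * 'D_v f x)) => //.
  by move=> y Uy; have [] := H y v Uy.
apply: Ck_mul => //; last exact: dfk.
by apply: IH; [exact: UO|exact: dgk|exact: CkS].
Qed.

(** For functions of one variable the directional derivatives are multiples of
    the usual derivative. *)
Lemma Ck1S k (O : set R) (f f' : R -> R) : open O ->
  (forall x, O x -> is_derive x 1 f (f' x)) -> Ck k O f' -> Ck k.+1 O f.
Proof.
move=> oO ff' f'k; have df x : O x -> differentiable f x.
  by move=> /ff'[] /derivable1_diffP.
split=> // v; apply: (@Ck_eq _ _ _ _ (fun x => v * f' x)).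
  exact: oO.
  move=> y Oy; have dfy := df _ Oy; rewrite deriveE//.
  have -> : 'd f y v = v *: 'd f y 1 by rewrite -linearZ /= [_ *: 1]mulr1.
  by have [_ <-] := ff' _ Oy; rewrite deriveE.
by apply: Ck_mul => //; exact: Ck_cst.
Qed.

End SmoothCalculus.

Section SmoothMaps.
Variable R : realType.
Implicit Types V W : normedModType R.

Lemma smooth_eq V W (U : set V) (f g : V -> W) :
  open U -> (forall y, U y -> f y = g y) -> smooth_on U f -> smooth_on U g.
Proof. by move=> oU fg sf k; exact: (Ck_eq oU fg (sf k)). Qed.

Lemma smooth_cst V W (U : set V) (c : W) : smooth_on U (cst c : V -> W).
Proof. by move=> k; exact: Ck_cst. Qed.

Lemma smooth_add V W (U : set V) (f g : V -> W) : open U ->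
  smooth_on U f -> smooth_on U g -> smooth_on U (fun x => f x + g x).
Proof. by move=> oU sf sg k; exact: Ck_add. Qed.

Lemma smooth_sum V W (U : set V) n (f : 'I_n -> V -> W) : open U ->
  (forall i, smooth_on U (f i)) -> smooth_on U (fun x => \sum_i f i x).
Proof. by move=> oU sf k; apply: Ck_sum => // i; exact: sf. Qed.

Lemma smooth_mul V (U : set V) (f g : V -> R) : open U ->
  smooth_on U f -> smooth_on U g -> smooth_on U (fun x => f x * g x).
Proof. by move=> oU sf sg k; exact: Ck_mul. Qed.

Lemma smooth_prod V (U : set V) n (f : 'I_n -> V -> R) : open U ->
  (forall i, smooth_on U (f i)) -> smooth_on U (fun x => \prod_i f i x).
Proof.
move=> oU; elim: n f => [|n IH] f fk.
  apply: (@smooth_eq _ _ _ (fun=> 1 : R)) => // [y _|]; first by rewrite big_ord0.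
  exact: smooth_cst.
apply: (@smooth_eq _ _ _ (fun x => f ord0 x * \prod_i f (lift ord0 i) x)) => //.
  by move=> y _; rewrite big_ord_recl.
by apply: smooth_mul => //; exact: IH.
Qed.

Lemma smooth_comp1 V (U : set V) (O : set R) (f : V -> R) (g : R -> R) :
  open U -> (forall x, U x -> O (f x)) -> smooth_on O g -> smooth_on U f ->
  smooth_on U (g \o f).
Proof. by move=> oU UO sg sf k; apply: (Ck_comp1 oU UO). Qed.

Lemma smooth_derive V W (U : set V) (f : V -> W) v :
  smooth_on U f -> smooth_on U ('D_v f).
Proof. by move=> sf k; have [_] := sf k.+1; apply. Qed.

Lemma smooth_differentiable V W (U : set V) (f : V -> W) x :
  smooth_on U f -> U x -> differentiable f x.
Proof. by move=> /(_ 1)[+ _]; apply. Qed.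

(** Here linearity is a property of a function, so that it can be checked on
    projections and on lambda terms. *)
Lemma linear_diff V W (l : V -> W) x v : linear l -> continuous l ->
  differentiable l x /\ 'd l x v = l v.
Proof.
move=> ll lc.
pose lL : {linear V -> W} := HB.pack l (GRing.isLinear.Build _ _ _ _ l ll).
have lcL : continuous lL by exact: lc.
split; first exact: (linear_differentiable x lcL).
by rewrite (diff_lin x lcL).
Qed.

Lemma derive_linear V W1 W2 (l : W1 -> W2) (f : V -> W1) x v :
  linear l -> continuous l -> differentiable f x ->
  'D_v (l \o f) x = l ('D_v f x).
Proof.
move=> ll lc df; have [dl lE] := linear_diff (f x) ('D_v f x) ll lc.
by rewrite derive_comp.
Qed.

Lemma smooth_linear V W1 W2 (U : set V) (l : W1 -> W2) (f : V -> W1) :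
  open U -> linear l -> continuous l -> smooth_on U f -> smooth_on U (l \o f).
Proof.
move=> oU ll lc sf k.
pose lL : {linear W1 -> W2} := HB.pack l (GRing.isLinear.Build _ _ _ _ l ll).
have lcL : continuous lL by exact: lc.
exact: (Ck_linear oU lcL (sf k)).
Qed.

Lemma smooth_id V (U : set V) : smooth_on U id.
Proof.
move=> [|k] /=; first by move=> x _.
split=> [x _|v]; first exact: ex_diff.
rewrite (_ : 'D_v _ = cst v); first exact: Ck_cst.
by apply/funext => x; rewrite derive_id.
Qed.

Lemma linear_rVcoord n (j : 'I_n) :
  linear (fun x : 'rV[R]_n => x 0 j : R).
Proof. by move=> c x y; rewrite !mxE. Qed.

Lemma continuous_fst V W : continuous (fst : V * W -> V).
Proof. by move=> x; exact: cvg_fst. Qed.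

Lemma continuous_snd V W : continuous (snd : V * W -> W).
Proof. by move=> x; exact: cvg_snd. Qed.

Lemma smooth_coord V n (U : set V) (f : V -> 'rV[R]_n) j : open U ->
  smooth_on U f -> smooth_on U (fun x => f x 0 j).
Proof.
move=> oU; apply: (@smooth_linear _ _ _ _ (fun x : 'rV[R]_n => x 0 j)) => //.
- exact: linear_rVcoord.
- exact: coord_continuous.
Qed.

Lemma smooth_rV V n (U : set V) (f : V -> 'rV[R]_n) : open U ->
  (forall j, smooth_on U (fun x => f x 0 j)) -> smooth_on U f.
Proof.
move=> oU sf.
apply: (@smooth_eq _ _ _ (fun x => \sum_j f x 0 j *: delta_mx 0 j)) => //.
  by move=> y _; rewrite -row_sum_delta.
apply: smooth_sum => // j.
apply: (@smooth_linear _ _ _ _ (fun t : R => t *: delta_mx 0 j)) => //.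
- by move=> c x y; rewrite scalerDl scalerA.
- exact: scalel_continuous.
Qed.

Lemma smooth_fst V W1 W2 (U : set V) (f : V -> W1 * W2) : open U ->
  smooth_on U f -> smooth_on U (fun x => (f x).1).
Proof.
move=> oU; apply: (@smooth_linear _ _ _ _ fst) => //.
exact: continuous_fst.
Qed.

Lemma smooth_snd V W1 W2 (U : set V) (f : V -> W1 * W2) : open U ->
  smooth_on U f -> smooth_on U (fun x => (f x).2).
Proof.
move=> oU; apply: (@smooth_linear _ _ _ _ snd) => //.
exact: continuous_snd.
Qed.

Lemma smooth_pair V W1 W2 (U : set V) (f : V -> W1) (g : V -> W2) : open U ->
  smooth_on U f -> smooth_on U g -> smooth_on U (fun x => (f x, g x)).
Proof.
move=> oU sf sg.
apply: (@smooth_eq _ _ _ (fun x => (f x, 0) + (0, g x))) => //.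
  by move=> y _; congr (_, _); rewrite ?addr0 ?add0r.
apply: smooth_add => //.
  apply: (@smooth_linear _ _ _ _ (fun t => (t, 0))) => //.
    by move=> c x y; congr (_, _); rewrite /= scaler0 addr0.
  by move=> x; apply: cvg_pair => //; exact: cvg_cst.
apply: (@smooth_linear _ _ _ _ (fun t => (0, t))) => //.
  by move=> c x y; congr (_, _); rewrite /= scaler0 addr0.
by move=> x; apply: cvg_pair => //; exact: cvg_cst.
Qed.

End SmoothMaps.

Section SmoothReal.
Variable R : realType.

(** A primitive of a smooth function is smooth. *)
Lemma smooth_open1 (O : set R) (f f' : R -> R) : open O ->
  (forall x, O x -> is_derive x 1 f (f' x)) -> smooth_on O f' -> smooth_on O f.
Proof.
by move=> oO ff' sf' k; apply: CkS; apply: (Ck1S oO ff' (sf' k)).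
Qed.

Lemma smooth_expR (O : set R) : open O -> smooth_on O (@expR R).
Proof.
move=> oO; elim=> [|k IH]; first by move=> x _; exact: continuous_expR.
by apply: (@Ck1S _ _ _ _ expR) => // x _; exact: is_derive_expR.
Qed.

Lemma smooth_sin_cos (O : set R) : open O ->
  smooth_on O (@sin R) /\ smooth_on O (@cos R).
Proof.
move=> oO; suff H k : Ck k O (@sin R) /\ Ck k O (@cos R).
  by split=> k; have [] := H k.
elim: k => [|k [IHs IHc]].
  by split=> x _; [exact: continuous_sin|exact: continuous_cos].
split; first by apply: (@Ck1S _ _ _ _ cos) => // x _; exact: is_derive_sin.
apply: (@Ck1S _ _ _ _ (fun x => -1 * sin x)) => // [x _|].
  by rewrite mulN1r; exact: is_derive_cos.
by apply: Ck_mul => //; exact: Ck_cst.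
Qed.

Lemma open_neq0 : open [set x : R | x != 0].
Proof. exact: open_neq. Qed.

Lemma smooth_inv : smooth_on [set x : R | x != 0] (@GRing.inv R).
Proof.
elim=> [|k IH]; first by move=> x x0; exact: inv_continuous.
apply: (@Ck1S _ _ _ _ (fun x => -1 * (x^-1 * x^-1))) => [|x x0|].
- exact: open_neq0.
- have -> : -1 * (x^-1 * x^-1) = - x ^- 2 *: 1 :> R.
    by rewrite [_ *: _]mulr1 mulN1r expr2 invfM.
  exact: is_deriveV.
- apply: Ck_mul; [exact: open_neq0|exact: Ck_cst|].
  by apply: Ck_mul => //; exact: open_neq0.
Qed.

Lemma smooth_sqrt : smooth_on [set x : R | 0 < x] (@Num.sqrt R).
Proof.
have o0 : open [set x : R | 0 < x] by exact: open_gt.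
elim=> [|k IH]; first by move=> x x0; exact: sqrt_continuous.
apply: (@Ck1S _ _ _ _ (fun x => (2 * Num.sqrt x)^-1)) => //.
apply: (@Ck_comp1 _ _ _ _ [set x : R | x != 0] (fun x => 2 * Num.sqrt x)) => //.
- by move=> x x0; rewrite /= gt_eqF// mulr_gt0// sqrtr_gt0.
- exact: smooth_inv.
- by apply: Ck_mul => //; exact: Ck_cst.
Qed.

End SmoothReal.

(** * The primitive of a continuous function *)

Section OrientedIntegral.
Variable R : realType.
Implicit Type f : R -> R.

(** The oriented integral from [b] is a difference of integrals from any point
    [c] on the left of both bounds. *)
Lemma oriented_integralE f (b c t : R) : continuous f -> c <= b -> c <= t ->
  oriented_integral f b t = \int[lebesgue_measure]_(x in `[c, t]) f x -
                            \int[lebesgue_measure]_(x in `[c, b]) f x.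
Proof.
move=> cf.
have fi x y : lebesgue_measure.-integrable `[x, y] (EFin \o f).
  apply: continuous_compact_integrable; first exact: segment_compact.
  exact: continuous_subspaceT.
have H x y : c <= x -> x <= y ->
    \int[lebesgue_measure]_(t in `[x, y]) f t =
    \int[lebesgue_measure]_(t in `[c, y]) f t -
    \int[lebesgue_measure]_(t in `[c, x]) f t.
  move=> cx xy; rewrite (@Rintegral_itvB _ f (BLeft c) (BRight y) x)//.
  rewrite Rintegral_itv_obnd_cbnd//.
  by apply: integrableS (fi x y) => //; apply: subset_itvr; rewrite bnd_simp.
move=> cb ct; rewrite /oriented_integral.
have [bt|tb] := leP b t; first by rewrite (H b t).
by rewrite (H t b ct (ltW tb)) opprB.
Qed.

Lemma is_derive_oriented_integral f (b s : R) : continuous f ->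
  is_derive s 1 (oriented_integral f b) (f s).
Proof.
(* The base point lies strictly on the left of [s] and [b]: [s] is interior to
   the interval of integration, whatever its position with respect to [b]. *)
move=> cf; pose c := Num.min s b - 1.
have cs : c < s by rewrite /c ltrBlDr (@le_lt_trans _ _ s)// ?ltrDl// ge_min lexx.
have cb : c < b.
  by rewrite /c ltrBlDr (@le_lt_trans _ _ b)// ?ltrDl// ge_min lexx orbT.
pose F t := \int[lebesgue_measure]_(x in `[c, t]) f x.
have fi : lebesgue_measure.-integrable `[c, s + 1] (EFin \o f).
  apply: continuous_compact_integrable; first exact: segment_compact.
  exact: continuous_subspaceT.
have s1 : s < s + 1 by rewrite ltrDl.
have [dF F's] := continuous_FTC1_closed s1 fi cs (cf s).
apply: (@near_eq_is_derive _ _ _ (fun t => F t + - F b)).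
  near=> t; rewrite (oriented_integralE cf (ltW cb))//.
  apply/ltW; near: t; exact: lt_nbhsr.
rewrite -[f s]addr0; apply: (@is_deriveD _ _ _ F (cst (- F b))).
by rewrite -F's derive1E; exact: derivableP.
Unshelve. all: by end_near. Qed.

End OrientedIntegral.

Section DeriveRules.
Variables (R : realType) (V : normedModType R).
Implicit Types (f g : V -> R) (x v : V).

Lemma is_derive_mul f g x v a b : is_derive x v f a -> is_derive x v g b ->
  is_derive x v (fun t => f t * g t) (a * g x + f x * b).
Proof.
move=> df dg; have := is_deriveM df dg.
suff -> : f x *: b + g x *: a = a * g x + f x * b by [].
by rewrite addrC [a * _]mulrC.
Qed.

Lemma is_derive_add f g x v a b : is_derive x v f a -> is_derive x v g b ->
  is_derive x v (fun t => f t + g t) (a + b).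
Proof. exact: is_deriveD. Qed.

Lemma is_derive_comp1 f (g : R -> R) x v a d : differentiable f x ->
  is_derive x v f a -> is_derive (f x) 1 g d ->
  is_derive x v (g \o f) (d * a).
Proof.
move=> df [_ <-] dg; have [dgf <-] := differentiable_comp1 v df dg.
by apply: derivableP; exact: diff_derivable.
Qed.

Lemma is_derive_inv (f : R -> R) (x v a : R) : f x != 0 ->
  is_derive x v f a -> is_derive x v (fun t => (f t)^-1) (- (f x) ^- 2 * a).
Proof. exact: is_deriveV. Qed.

End DeriveRules.

Section DeriveProd.
Variable R : realType.

(** The logarithmic derivative of a product. *)
Lemma is_derive_prod n (f : 'I_n -> R -> R) (d : 'I_n -> R) (x : R) :
  (forall i, is_derive x 1 (f i) (d i)) -> (forall i, f i x != 0) ->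
  is_derive x 1 (fun t => \prod_i f i t) ((\prod_i f i x) * \sum_i d i / f i x).
Proof.
elim: n f d => [|n IH] f d fd f0.
  rewrite (_ : (fun t => _) = cst 1); last first.
    by apply/funext => t; rewrite big_ord0.
  by rewrite [\sum_i _]big_ord0 mulr0; exact: is_derive_cst.
rewrite (_ : (fun t => _) =
    (fun t => f ord0 t * \prod_i f (lift ord0 i) t)); last first.
  by apply/funext => t; rewrite big_ord_recl.
have := is_derive_mul (fd ord0) (IH _ _ (fun i => fd (lift ord0 i))
  (fun i => f0 (lift ord0 i))).
set u := (X in is_derive _ _ _ X -> _); set w := (X in _ -> is_derive _ _ _ X).
suff -> : u = w by [].
rewrite {}/u {}/w !big_ord_recl /=; have := f0 ord0.
set A := \sum_i _; set B := \prod_i _.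
by move=> ?; field.
Qed.

End DeriveProd.

(** * The profile curves *)

Section Profile.
Variables (R : realType) (n : nat) (a psi : 'I_n -> R) (E alpha : R).
Hypotheses (ha : forall j, 0 < a j) (hE : 1 < E) (halpha : 0 <= alpha).

Local Notation r := (Defs.rad a).
Local Notation phi := (phase a psi E alpha).

(** The quantity whose excess over 1 is under the square root in the phases. *)
Definition energy (t : R) : R :=
  E * (\prod_(k < n) (1 + a k * t ^+ 2)) * expR (alpha * t ^+ 2).

(** The common value of [r_j ^ 2 * phi_j'], which does not depend on [j]. *)
Definition slope (t : R) : R := `|t| / Num.sqrt (energy t - 1).

(** The derivative of [slope] away from the origin. *)
Definition slope' (t : R) : R :=
  (slope t - (t ^+ 2 + slope t ^+ 2) * slope t *
             (\sum_k (r k t ^+ 2)^-1 + alpha)) / t.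

Lemma radius2_gt0 j t : 0 < (a j)^-1 + t ^+ 2.
Proof. by rewrite ltr_pwDl ?invr_gt0 ?sqr_ge0. Qed.

Lemma rad_gt0 j t : 0 < r j t.
Proof. by rewrite sqrtr_gt0 radius2_gt0. Qed.

Lemma rad_neq0 j t : r j t != 0.
Proof. by rewrite gt_eqF// rad_gt0. Qed.

Lemma rad_sqr j t : r j t ^+ 2 = (a j)^-1 + t ^+ 2.
Proof. by rewrite sqr_sqrtr// ltW// radius2_gt0. Qed.

Lemma factor_gt0 k t : 0 < 1 + a k * t ^+ 2.
Proof. by rewrite ltr_pwDl// mulr_ge0 ?sqr_ge0 ?ltW. Qed.

Lemma energy_gt1 t : 1 < energy t.
Proof.
rewrite /energy; have e1 : 1 <= expR (alpha * t ^+ 2).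
  by rewrite -expR0 ler_expR mulr_ge0// sqr_ge0.
have p1 : 1 <= \prod_(k < n) (1 + a k * t ^+ 2).
  elim/big_ind : _ => // [x y x1 y1|k _]; first by rewrite mulr_ege1.
  by rewrite lerDl mulr_ge0 ?sqr_ge0 ?ltW.
rewrite -mulrA (lt_le_trans hE)// ler_peMr ?mulr_ege1//.
by rewrite ltW// (lt_trans ltr01).
Qed.

Lemma sqrt_energy_gt0 t : 0 < Num.sqrt (energy t - 1).
Proof. by rewrite sqrtr_gt0 subr_gt0 energy_gt1. Qed.

Lemma slope_neq0 t : t != 0 -> slope t != 0.
Proof.
by move=> t0; rewrite mulf_neq0 ?normr_eq0// invr_neq0// gt_eqF// sqrt_energy_gt0.
Qed.

Lemma smooth_sqr (O : set R) : open O -> smooth_on O (fun t : R => t ^+ 2).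
Proof. by move=> oO; apply: smooth_mul => //; exact: smooth_id. Qed.

(** The function [|t|] is [sqrt (t ^ 2)]. *)
Lemma smooth_normr : smooth_on (nonzero R) (fun t : R => `|t|).
Proof.
have o0 : open (nonzero R) := @open_neq0 R.
apply: (@smooth_eq _ _ _ _ (Num.sqrt \o (fun t => t ^+ 2))) => //.
  by move=> t _; rewrite /= sqrtr_sqr.
apply: (@smooth_comp1 _ _ _ [set x | 0 < x]) => //.
- by move=> t t0; rewrite /= exprn_even_gt0.
- exact: smooth_sqrt.
- exact: smooth_sqr.
Qed.

Lemma smooth_energy (O : set R) : open O -> smooth_on O energy.
Proof.
move=> oO; have s2 := smooth_sqr oO.
apply: smooth_mul => //.
  apply: smooth_mul => //; first exact: smooth_cst.
  apply: smooth_prod => // k; apply: smooth_add => //; first exact: smooth_cst.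
  by apply: smooth_mul => //; exact: smooth_cst.
apply: (@smooth_comp1 _ _ _ setT (fun t : R => alpha * t ^+ 2) _ oO _
  (smooth_expR openT)) => //.
by apply: smooth_mul => //; exact: smooth_cst.
Qed.

Lemma smooth_sqrt_energy (O : set R) : open O ->
  smooth_on O (fun t => (Num.sqrt (energy t - 1))^-1).
Proof.
move=> oO.
apply: (@smooth_comp1 _ _ _ [set x | x != 0]
  (fun t => Num.sqrt (energy t - 1)) _ oO _ (@smooth_inv R)).
  by move=> t _; rewrite /= gt_eqF// sqrt_energy_gt0.
apply: (@smooth_comp1 _ _ _ [set x | 0 < x]
  (fun t => energy t - 1) _ oO _ (@smooth_sqrt R)).
  by move=> t _; rewrite /= subr_gt0 energy_gt1.
by apply: smooth_add => //; [exact: smooth_energy|exact: smooth_cst].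
Qed.

Lemma smooth_radius2 j (O : set R) : open O ->
  smooth_on O (fun t => (a j)^-1 + t ^+ 2).
Proof.
by move=> oO; apply: smooth_add => //; [exact: smooth_cst|exact: smooth_sqr].
Qed.

Lemma smooth_rad j (O : set R) : open O -> smooth_on O (r j).
Proof.
move=> oO; apply: (@smooth_comp1 _ _ _ [set x | 0 < x]
  (fun t : R => (a j)^-1 + t ^+ 2) _ oO _ (@smooth_sqrt R)).
  by move=> t _; exact: radius2_gt0.
exact: smooth_radius2.
Qed.

(** The integrand defining the j-th phase. *)
Let speed j (t : R) : R := `|t| / (((a j)^-1 + t ^+ 2) *
     Num.sqrt (E * (\prod_(k < n) (1 + a k * t ^+ 2)) *
               expR (alpha * t ^+ 2) - 1)).

Let speedE j t : speed j t = slope t / r j t ^+ 2.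
Proof. by rewrite /speed /slope rad_sqr invfM mulrA mulrAC. Qed.

Let speedE' j t : speed j t =
  `|t| * (((a j)^-1 + t ^+ 2)^-1 * (Num.sqrt (energy t - 1))^-1).
Proof. by rewrite /speed -invfM. Qed.

Let smooth_weight j (O : set R) : open O ->
  smooth_on O (fun t => ((a j)^-1 + t ^+ 2)^-1 * (Num.sqrt (energy t - 1))^-1).
Proof.
move=> oO; apply: smooth_mul => //; last exact: smooth_sqrt_energy.
apply: (@smooth_comp1 _ _ _ [set x | x != 0]
  (fun t : R => (a j)^-1 + t ^+ 2) _ oO _ (@smooth_inv R)).
  by move=> t _; rewrite /= gt_eqF// radius2_gt0.
exact: smooth_radius2.
Qed.

Let smooth_speed j : smooth_on (nonzero R) (speed j).
Proof.
have o0 : open (nonzero R) := @open_neq0 R.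
apply: (smooth_eq o0 (fun t _ => esym (speedE' j t))).
by apply: smooth_mul => //; [exact: smooth_normr|exact: smooth_weight].
Qed.

(** Unlike smoothness, continuity also holds at the origin, across which the
    phases are integrated. *)
Let continuous_speed j : continuous (speed j).
Proof.
rewrite (_ : speed j = (fun t => `|t| * (((a j)^-1 + t ^+ 2)^-1 *
   (Num.sqrt (energy t - 1))^-1))); last first.
  by apply/funext => t; exact: speedE'.
move=> t; apply: (@continuousM _ R); first exact: norm_continuous.
exact: (smooth_weight j openT 0%N).
Qed.

Lemma is_derive_phase j (t : R) : is_derive t 1 (phi j) (slope t / r j t ^+ 2).
Proof.
have := is_derive_add (is_derive_cst (psi j) t 1)
  (is_derive_oriented_integral 0 t (continuous_speed (j:=j))).
by rewrite add0r speedE.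
Qed.

Lemma smooth_phase j : smooth_on (nonzero R) (phi j).
Proof.
apply: (smooth_open1 (@open_neq0 R) (f' := speed j)); last exact: smooth_speed.
by move=> t _; rewrite speedE; exact: is_derive_phase.
Qed.

Lemma is_derive_rad j (t : R) : is_derive t 1 (r j) (t / r j t).
Proof.
have d2 : is_derive t 1 (fun t => (a j)^-1 + t ^+ 2) (t *+ 2).
  have := is_derive_add (is_derive_cst (a j)^-1 t 1)
    (is_derive_mul (is_derive_id t (1 : R)) (is_derive_id t (1 : R))).
  by rewrite add0r mul1r mulr1 -mulr2n.
have := @is_derive1_comp R (@Num.sqrt R) (fun t => (a j)^-1 + t ^+ 2) t _ _
  (is_derive1_sqrt (radius2_gt0 j t)) d2.
suff -> : (2 * Num.sqrt ((a j)^-1 + t ^+ 2))^-1 * (t *+ 2) = t / r j t by [].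
rewrite -/(r j t); have := rad_neq0 j t; move: (r j t) => u u0.
by field.
Qed.

Lemma is_derive_energy (t : R) : t != 0 ->
  is_derive t 1 energy
    (2 * t * energy t * (\sum_k (r k t ^+ 2)^-1 + alpha)).
Proof.
move=> t0.
have d2 (c e : R) : is_derive t 1 (fun t => c + e * t ^+ 2) (e * (t *+ 2)).
  have := is_derive_add (is_derive_cst c t 1)
    (is_derive_mul (is_derive_cst e t 1)
      (is_derive_mul (is_derive_id t (1 : R)) (is_derive_id t (1 : R)))).
  by rewrite add0r mul0r add0r mul1r mulr1 -mulr2n.
have de : is_derive t 1 (fun t => expR (alpha * t ^+ 2))
    (expR (alpha * t ^+ 2) * (alpha * (t *+ 2))).
  have da : is_derive t 1 (fun t => alpha * t ^+ 2) (alpha * (t *+ 2)).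
    have := d2 0 alpha.
    by rewrite (_ : (fun t => 0 + _) = (fun t => alpha * t ^+ 2))//;
      apply/funext => u; rewrite add0r.
  exact: (@is_derive1_comp R (@expR R) (fun t => alpha * t ^+ 2) t _ _
    (is_derive_expR _) da).
have dp := is_derive_prod (fun k => d2 1 (a k))
  (fun k => lt0r_neq0 (factor_gt0 k t)).
have := is_derive_mul (is_derive_mul (is_derive_cst E t 1) dp) de.
set u := (X in is_derive _ _ _ X -> _); set w := (X in _ -> is_derive _ _ _ X).
suff -> : u = w by [].
have -> : w = 2 * t * energy t * (\sum_k a k / (1 + a k * t ^+ 2) + alpha).
  rewrite /w; congr (_ * (_ + _)); apply: eq_bigr => k _.
  rewrite rad_sqr; have ak := lt0r_neq0 (ha k).
  have := lt0r_neq0 (factor_gt0 k t); have := lt0r_neq0 (radius2_gt0 k t).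
  by move=> ? ?; field; apply/andP.
rewrite /u /energy /=.
have -> : \sum_i a i * (t *+ 2) / (1 + a i * t ^+ 2) =
    (t *+ 2) * \sum_k a k / (1 + a k * t ^+ 2).
  by rewrite mulr_sumr; apply: eq_bigr => k _; rewrite [a k * _]mulrC -mulrA.
move: (\prod_k _) (\sum_k _) (expR _) => p s e.
by ring.
Qed.

Lemma is_derive_normr (t : R) : t != 0 ->
  is_derive t 1 (fun u : R => `|u|) (`|t| / t).
Proof.
move=> t0; rewrite (_ : (fun u => _) = Num.sqrt \o (fun u => u ^+ 2)); last first.
  by apply/funext => u; rewrite /= sqrtr_sqr.
have d2 := is_derive_mul (is_derive_id t (1 : R)) (is_derive_id t (1 : R)).
have t2 : 0 < t ^+ 2 by rewrite exprn_even_gt0.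
have := @is_derive1_comp R (@Num.sqrt R) (fun t => t ^+ 2) t _ _
  (is_derive1_sqrt t2) d2.
suff -> : (2 * Num.sqrt (t ^+ 2))^-1 * (1 * id t + id t * 1) = `|t| / t by [].
rewrite sqrtr_sqr /=.
have m0 : `|t| != 0 by rewrite normr_eq0.
have mt : `|t| ^+ 2 = t ^+ 2 by rewrite real_normK// num_real.
apply: (mulIf t0); apply: (mulIf m0).
rewrite [in RHS]divfK// -[RHS]expr2 mt.
by field.
Qed.

(** The derivative of [slope] carries the geometry of the construction: the
    logarithmic derivative of [energy] is [2 * t] times the sum of the
    [r_k ^ -2] and of [alpha]. *)
Lemma is_derive_slope (t : R) : t != 0 -> is_derive t 1 slope (slope' t).
Proof.
move=> t0; pose q t := Num.sqrt (energy t - 1).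
have q0 : q t != 0 by rewrite gt_eqF// sqrt_energy_gt0.
have q2 : energy t = q t ^+ 2 + 1.
  by rewrite sqr_sqrtr ?subrK// subr_ge0 ltW// energy_gt1.
have dP : is_derive t 1 (fun t => energy t - 1)
    (2 * t * energy t * (\sum_k (Defs.rad a k t ^+ 2)^-1 + alpha) + 0).
  exact: (is_derive_add (is_derive_energy t0) (is_derive_cst (-1 : R) t 1)).
have P1 : 0 < energy t - 1 by rewrite subr_gt0 energy_gt1.
have dq := @is_derive1_comp R (@Num.sqrt R) (fun t => energy t - 1) t _ _
  (is_derive1_sqrt P1) dP.
have dqV : is_derive t 1 (fun t => (q t)^-1) _ := is_derive_inv q0 dq.
have := is_derive_mul (is_derive_normr t0) dqV.
set u := (X in is_derive _ _ _ X -> _); set w := (X in _ -> is_derive _ _ _ X).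
suff -> : u = w by [].
have m2 : `|t| ^+ 2 = t ^+ 2 by rewrite real_normK// num_real.
rewrite /u /w /slope' /slope /= -/(q t) expr_div_n m2 q2.
move: (\sum_k _) (q t) q0 (`|t|) => s y y0 m.
by field; apply/andP.
Qed.

(** Real and imaginary parts of the profile curve [r_j * e^(i * phi_j)]. *)
Definition re_profile j t := r j t * cos (phi j t).
Definition im_profile j t := r j t * sin (phi j t).

(** First and second derivatives of the profile curve; with
    [q = t + i * slope t] they are [e^(i * phi_j) * (q / r_j)] and
    [e^(i * phi_j) * (q' / r_j - |q| ^ 2 / r_j ^ 3)]. As [q' = 1 + i * slope'],
    the real part of the last factor is [accel]. *)
Definition re_profile1 j t :=
  (t * cos (phi j t) - slope t * sin (phi j t)) / r j t.
Definition im_profile1 j t :=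
  (t * sin (phi j t) + slope t * cos (phi j t)) / r j t.
Definition accel j t := (r j t)^-1 - (t ^+ 2 + slope t ^+ 2) / r j t ^+ 3.
Definition re_profile2 j t :=
  accel j t * cos (phi j t) - slope' t / r j t * sin (phi j t).
Definition im_profile2 j t :=
  accel j t * sin (phi j t) + slope' t / r j t * cos (phi j t).

Lemma is_derive_cos_phase j (t : R) : is_derive t 1 (fun t => cos (phi j t))
  (- sin (phi j t) * (slope t / r j t ^+ 2)).
Proof. exact: is_derive1_comp (is_derive_cos _) (is_derive_phase j t). Qed.

Lemma is_derive_sin_phase j (t : R) : is_derive t 1 (fun t => sin (phi j t))
  (cos (phi j t) * (slope t / r j t ^+ 2)).
Proof. exact: is_derive1_comp (is_derive_sin _) (is_derive_phase j t). Qed.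

Lemma is_derive_radV j (t : R) :
  is_derive t 1 (fun t => (r j t)^-1) (- (t / r j t ^+ 3)).
Proof.
have := is_derive_inv (rad_neq0 j t) (is_derive_rad j t).
suff -> : - r j t ^- 2 * (t / r j t) = - (t / r j t ^+ 3) by [].
have := rad_neq0 j t; move: (r j t) => u u0.
by field.
Qed.

Lemma is_derive_re_profile j (t : R) :
  is_derive t 1 (re_profile j) (re_profile1 j t).
Proof.
have := is_derive_mul (is_derive_rad j t) (is_derive_cos_phase j t).
set u := (X in is_derive _ _ _ X -> _); set w := (X in _ -> is_derive _ _ _ X).
suff -> : u = w by [].
rewrite /u /w /re_profile1; have := rad_neq0 j t.
move: (r j t) (slope t) (sin _) (cos _) => x l s c x0.
by field.
Qed.

Lemma is_derive_im_profile j (t : R) :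
  is_derive t 1 (im_profile j) (im_profile1 j t).
Proof.
have := is_derive_mul (is_derive_rad j t) (is_derive_sin_phase j t).
set u := (X in is_derive _ _ _ X -> _); set w := (X in _ -> is_derive _ _ _ X).
suff -> : u = w by [].
rewrite /u /w /im_profile1; have := rad_neq0 j t.
move: (r j t) (slope t) (sin _) (cos _) => x l s c x0.
by field.
Qed.

Lemma is_derive_re_profile1 j (t : R) : t != 0 ->
  is_derive t 1 (re_profile1 j) (re_profile2 j t).
Proof.
move=> t0.
have d1 := is_derive_mul (is_derive_id t (1 : R)) (is_derive_cos_phase j t).
have d2 := is_derive_mul (is_derive_slope t0) (is_derive_sin_phase j t).
have := is_derive_mul (is_derive_add d1 (is_deriveN d2)) (is_derive_radV j t).
set u := (X in is_derive _ _ _ X -> _); set w := (X in _ -> is_derive _ _ _ X).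
suff -> : u = w by [].
rewrite /u /w /re_profile2 /accel /= !fctE; have := rad_neq0 j t.
move: (r j t) (slope' t) (slope t) (sin _) (cos _) => x l' l s c x0.
by field.
Qed.

Lemma is_derive_im_profile1 j (t : R) : t != 0 ->
  is_derive t 1 (im_profile1 j) (im_profile2 j t).
Proof.
move=> t0.
have d1 := is_derive_mul (is_derive_id t (1 : R)) (is_derive_sin_phase j t).
have d2 := is_derive_mul (is_derive_slope t0) (is_derive_cos_phase j t).
have := is_derive_mul (is_derive_add d1 d2) (is_derive_radV j t).
set u := (X in is_derive _ _ _ X -> _); set w := (X in _ -> is_derive _ _ _ X).
suff -> : u = w by [].
rewrite /u /w /im_profile2 /accel /=; have := rad_neq0 j t.
move: (r j t) (slope' t) (slope t) (sin _) (cos _) => x l' l s c x0.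
by field.
Qed.

Lemma smooth_profile j : smooth_on (nonzero R) (re_profile j) /\
  smooth_on (nonzero R) (im_profile j).
Proof.
have o0 : open (nonzero R) := @open_neq0 R.
have [ss sc] := smooth_sin_cos (@openT R).
have sp := smooth_phase j; have sr := smooth_rad j o0.
split; apply: smooth_mul => //.
  by apply: (@smooth_comp1 _ _ _ setT (phi j) _ o0 _ sc).
by apply: (@smooth_comp1 _ _ _ setT (phi j) _ o0 _ ss).
Qed.

End Profile.

(** * The cylinder over the sphere as a submanifold *)

Section Charts.
Variable R : realType.

Lemma smooth_continuous (V W : normedModType R) (f : V -> W) :
  smooth_on setT f -> continuous f.
Proof. by move=> sf x; exact: (sf 0%N). Qed.

(** A map with a linear left inverse has injective differentials. *)
Lemma diff_injective (V : normedModType R) m (U : set 'rV[R]_m)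
    (kappa : 'rV[R]_m -> V) (g : V -> 'rV[R]_m) :
  open U -> smooth_on U kappa -> linear g -> continuous g ->
  (forall u, U u -> g (kappa u) = u) ->
  forall u, U u -> injective ('d kappa u).
Proof.
move=> oU sk lg cg gk u Uu; apply: (can_inj (g := g)) => v.
have dk := smooth_differentiable sk Uu.
rewrite -deriveE// -derive_linear// -[RHS](derive_id u v).
exact: (derive_eq_on _ oU gk Uu).
Qed.

Variable n : nat.
Local Notation V := ('rV[R]_n * R)%type.
Implicit Types (j : 'I_n) (e : R) (u : 'rV[R]_n).

(** The graph charts of the cylinder: the j-th coordinate of the parameter is
    the real factor, and the other ones are coordinates on one of the two open
    hemispheres [0 < e * x_j], where [e] is a sign. The height [x_j ^ 2] is one
    minus the sum of the squares of the other coordinates; the term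
    [u_j ^ 2] cancels the one in the full sum. *)
Definition chart_height j u : R := 1 + u 0 j ^+ 2 - \sum_i u 0 i ^+ 2.

Definition chart_domain j : set 'rV[R]_n :=
  [set u : 'rV[R]_n | u 0 j != 0 /\ 0 < chart_height j u].

Definition chart j e u : V :=
  (\row_k (if k == j then e * Num.sqrt (chart_height j u) else u 0 k), u 0 j).

(** A linear left inverse of [chart j e], for all signs [e]. *)
Definition chart_inv j (p : V) : 'rV[R]_n :=
  \row_k (if k == j then p.2 else p.1 0 k).

(** The open set that cuts the image of [chart j e] out of the cylinder. *)
Definition hemisphere j e : set V :=
  [set p : V | p.2 != 0 /\ 0 < e * p.1 0 j].

Lemma smooth_entry (U : set 'rV[R]_n) j : open U ->
  smooth_on U (fun u : 'rV[R]_n => u 0 j).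
Proof. by move=> oU; apply: smooth_coord => //; exact: smooth_id. Qed.

Lemma smooth_height (U : set 'rV[R]_n) j : open U ->
  smooth_on U (chart_height j).
Proof.
move=> oU.
have s2 i : smooth_on U (fun u : 'rV[R]_n => u 0 i ^+ 2).
  by apply: smooth_mul => //; exact: smooth_entry.
apply: smooth_add => //.
  by apply: smooth_add => //; exact: smooth_cst.
apply: (@smooth_eq _ _ _ _ (fun u : 'rV[R]_n => -1 * \sum_i u 0 i ^+ 2)) => //.
  by move=> y _; rewrite mulN1r.
apply: smooth_mul => //; first exact: smooth_cst.
exact: smooth_sum.
Qed.

Lemma smooth_chart_inv j : smooth_on setT (chart_inv j).
Proof.
apply: smooth_rV; first exact: openT.
move=> k.
have oT := @openT V.
apply: (@smooth_eq _ _ _ _ (fun p : V => if k == j then p.2 else p.1 0 k)) => //.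
  by move=> p _; rewrite mxE.
case: (k == j); first by apply: smooth_snd => //; exact: smooth_id.
by apply: smooth_coord => //; apply: smooth_fst => //; exact: smooth_id.
Qed.

Lemma linear_chart_inv j : linear (chart_inv j).
Proof.
move=> c p q; apply/rowP => k; rewrite !mxE /=.
by case: ifP => // _; rewrite !mxE.
Qed.

Lemma open_chart_domain j : open (chart_domain j).
Proof.
have -> : chart_domain j =
    (fun u : 'rV[R]_n => u 0 j) @^-1` [set x | x != 0] `&`
    chart_height j @^-1` [set x | 0 < x] by [].
apply: openI; apply: open_comp.
- by move=> x _; exact: coord_continuous.
- exact: open_neq.
- by move=> x _; apply: smooth_continuous; apply: smooth_height; exact: openT.
- exact: open_gt.
Qed.

Lemma open_hemisphere j e : open (hemisphere j e).
Proof.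
have -> : hemisphere j e =
    (fun p : V => p.2) @^-1` [set x | x != 0] `&`
    (fun p : V => e * p.1 0 j) @^-1` [set x | 0 < x] by [].
have oT := @openT V.
apply: openI; apply: open_comp.
- by move=> x _; exact: cvg_snd.
- exact: open_neq.
- move=> x _; apply: smooth_continuous; apply: smooth_mul => //.
    exact: smooth_cst.
  by apply: smooth_coord => //; apply: smooth_fst => //; exact: smooth_id.
- exact: open_gt.
Qed.

Lemma smooth_chart j e : smooth_on (chart_domain j) (chart j e).
Proof.
have oU := @open_chart_domain j.
apply: smooth_pair => //; last exact: smooth_entry.
apply: smooth_rV => // k.
apply: (@smooth_eq _ _ _ _ (fun u : 'rV[R]_n => if k == j then
   e * Num.sqrt (chart_height j u) else u 0 k)) => //.
  by move=> p _; rewrite mxE.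
case: (k == j); last exact: smooth_entry.
apply: smooth_mul => //; first exact: smooth_cst.
apply: (@smooth_comp1 _ _ _ _ (chart_height j) _ oU _ (@smooth_sqrt R)).
  by move=> u [].
exact: smooth_height.
Qed.

Lemma chartK j e u : chart_inv j (chart j e u) = u.
Proof.
apply/rowP => k; rewrite !mxE /=; by case: eqP => [->|].
Qed.

Lemma chart_heightE j u :
  chart_height j u = 1 - \sum_(i | i != j) u 0 i ^+ 2.
Proof. by rewrite /chart_height (bigD1 j) //= opprD addrA addrK. Qed.

Lemma chart_image j e : e ^+ 2 = 1 ->
  chart j e @` chart_domain j = Ldomain R n `&` hemisphere j e.
Proof.
move=> e2; apply/seteqP; split=> [_ [u [uj0 hu] <-]|[x s]].
  split; split=> //=.
    change (\sum_k (chart j e u).1 0 k ^+ 2 = 1).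
    rewrite (bigD1 j)//= mxE eqxx exprMn e2 mul1r sqr_sqrtr ?ltW//.
    rewrite (eq_bigr (fun i => u 0 i ^+ 2)); last first.
      by move=> i /negbTE ij; rewrite mxE ij.
    by rewrite chart_heightE subrK.
  by rewrite mxE eqxx mulrA -expr2 e2 mul1r sqrtr_gt0.
case=> -[x1 s0] [_ /= exj].
have {}x1 : \sum_k x 0 k ^+ 2 = 1 by exact: x1.
have H : chart_height j (chart_inv j (x, s)) = x 0 j ^+ 2.
  move: x1; rewrite chart_heightE (bigD1 j)//= => <-.
  rewrite [X in _ - X](eq_bigr (fun i => x 0 i ^+ 2)) ?addrK//.
  by move=> i /negbTE ij; rewrite mxE ij.
exists (chart_inv j (x, s)).
  split; first by rewrite mxE eqxx.
  rewrite H exprn_even_gt0//=; apply: contraTN exj => /eqP ->.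
  by rewrite mulr0 ltxx.
congr (_, _); last by rewrite mxE eqxx.
apply/rowP => k; rewrite !mxE H sqrtr_sqr; case: eqP => [->|//].
have ee : e * e = 1 by rewrite -expr2.
have -> : `|x 0 j| = `|e * (e * x 0 j)| by rewrite mulrA ee mul1r.
rewrite normrM (gtr0_norm exj).
have e1 : `|e| = 1.
  by apply/eqP; rewrite -(@eqrXn2 _ 2)// real_normK ?num_real// e2 expr1n.
by rewrite e1 mul1r mulrA ee mul1r.
Qed.

Lemma chart_local_param j e : e ^+ 2 = 1 ->
  local_param (Ldomain R n) (chart_domain j) (chart j e).
Proof.
move=> e2; have oU := @open_chart_domain j; have sk := @smooth_chart j e.
have cg := smooth_continuous (@smooth_chart_inv j).
split=> //.
- by apply: (diff_injective oU sk (@linear_chart_inv j) cg) => u _; exact: chartK.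
- by exists (hemisphere j e); [exact: open_hemisphere|exact: chart_image].
- exists (chart_inv j); first exact: continuous_subspaceT.
  by move=> u _; exact: chartK.
Qed.

Lemma submanifold_Ldomain : submanifold n (Ldomain R n).
Proof.
move=> [x s] [x1 s0].
have {}x1 : \sum_k x 0 k ^+ 2 = 1 by exact: x1.
have [j xj] : exists j, x 0 j != 0.
  apply/existsP; rewrite -[[exists _, _]]negbK negb_exists.
  apply/negP => /forallP x0.
  move: x1; rewrite big1 => [/esym/eqP|i _]; first by rewrite oner_eq0.
  by have := x0 i; rewrite negbK => /eqP ->; rewrite expr0n.
have e2 : Num.sg (x 0 j) ^+ 2 = 1 by rewrite sqr_sg xj.
exists (chart_domain j), (chart j (Num.sg (x 0 j))).
split; first exact: chart_local_param.
rewrite chart_image//; split; split=> //=.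
by rewrite -normrEsg normr_gt0.
Qed.

End Charts.

Lemma within_continuous_pullback (T1 T2 T3 : topologicalType) (A : set T1)
    (B : set T2) (h : T1 -> T2) (g : T2 -> T3) :
  continuous h -> (forall z, A z -> B (h z)) -> {within B, continuous g} ->
  {within A, continuous (g \o h)}.
Proof.
move=> ch AB /subspace_continuousP cg; apply/subspace_continuousP => x Ax N gN.
have BN : nbhs (h x) (fun y => B y -> N (g y)) := cg _ (AB _ Ax) N gN.
have : nbhs x (h @^-1` (fun y => B y -> N (g y))) := ch x _ BN.
by apply: filterS => z /= zN Az; apply: zN; exact: AB.
Qed.

(** * Transport by the exchange of factors *)

Section Swap.
Variables (R : realType) (V W : normedModType R).

Definition swap (p : V * W) : W * V := (p.2, p.1).

Lemma linear_swap : linear swap.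
Proof. by move=> c x y. Qed.

Lemma continuous_swap : continuous swap.
Proof. by move=> p; apply: cvg_pair; [exact: cvg_snd|exact: cvg_fst]. Qed.

Lemma smooth_map_swap m (M : set (V * W)) : smooth_map m M swap.
Proof.
move=> U kappa [oU sk _ _ _].
by apply: smooth_linear => //; exact: continuous_swap.
Qed.

End Swap.

Lemma swapK (R : realType) (V W : normedModType R) (p : V * W) :
  swap (swap p) = p.
Proof. by case: p. Qed.

Lemma submanifold_swap (R : realType) (V W : normedModType R) m
    (M : set (V * W)) :
  submanifold m M -> submanifold m (@swap R V W @` M).
Proof.
move=> sM _ [p Mp <-].
have [U [kappa [[oU sk ik [Q oQ kQ] [g cg gk]] kp]]] := sM p Mp.
exists U, (@swap R V W \o kappa); split; last first.
  by have [u Uu <-] := kp; exists u.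
split=> //.
- by apply: smooth_linear => //; exact: continuous_swap.
- move=> u Uu; have dk := smooth_differentiable sk Uu.
  have H v : 'd (@swap R V W \o kappa) u v = swap ('d kappa u v).
    have [dsw _] := linear_diff (kappa u) 0 (@linear_swap R V W)
      (@continuous_swap R V W).
    have dsk := differentiable_comp dk dsw.
    by rewrite -deriveE// derive_linear// ?deriveE//; exact: continuous_swap.
  move=> v w; rewrite !H => /(congr1 (@swap R W V)); rewrite !swapK.
  exact: ik.
- exists (@swap R W V @^-1` Q).
    by apply: open_comp => // x _; exact: continuous_swap.
  apply/seteqP; split=> [_ [u Uu <-]| _ [[p' Mp' <-] Op']].
    have [Mk Ok] : (M `&` Q) (kappa u) by rewrite -kQ; exists u.
    by split; [exists (kappa u)|rewrite /= swapK].
  have [u Uu up'] : (kappa @` U) p'.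
    by rewrite kQ; split=> //; move: Op'; rewrite /= swapK.
  by exists u => //=; rewrite up'.
- exists (g \o @swap R W V); last by move=> u Uu /=; rewrite swapK gk.
  apply: (within_continuous_pullback (@continuous_swap R W V) _ cg).
  by move=> _ [u Uu <-]; exists u => //=; rewrite swapK.
Qed.

(** * Linear algebra of tangent and normal spaces *)

Section Normal.
Variable R : realType.

Lemma dotE N (u v : 'rV[R]_N) : dot u v = (u *m v^T) 0 0.
Proof. by rewrite mxE; apply: eq_bigr => i _; rewrite mxE. Qed.

Lemma dot_eq0 N (v : 'rV[R]_N) : dot v v = 0 -> v = 0.
Proof.
move=> /eqP; rewrite psumr_eq0 => [/allP v0|i _]; last exact: sqr_ge0.
apply/rowP => i; rewrite mxE; apply/eqP; rewrite -sqrf_eq0 expr2.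
exact: (v0 i (mem_index_enum i)).
Qed.

(** The orthogonal complement meets the row space trivially, so that the
    projection [normal_part] is a genuine one. *)
Lemma kermx_trmx_cap m N (A : 'M[R]_(m, N)) :
  (kermx A^T :&: <<A>>)%MS = 0.
Proof.
apply/eqP/rowV0P => v; rewrite sub_capmx genmxE => /andP[/sub_kermxP vA].
move=> /submxP[y vE]; apply: dot_eq0; rewrite dotE.
by rewrite [in X in _ *m X]vE trmx_mul mulmxA vA mul0mx mxE.
Qed.

Lemma normal_part_tangent m N (A : 'M[R]_(m, N)) w :
  (w <= A)%MS -> normal_part A w = 0.
Proof.
move=> wA; apply: proj_mx_0; first exact: kermx_trmx_cap.
by rewrite genmxE.
Qed.

Lemma normal_partB m N (A : 'M[R]_(m, N)) v w :
  normal_part A (v - w) = normal_part A v - normal_part A w.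
Proof. exact: mulmxBl. Qed.

Lemma normal_partZ m N (A : 'M[R]_(m, N)) c w :
  normal_part A (c *: w) = c *: normal_part A w.
Proof. by rewrite /normal_part scalemxAl. Qed.

Lemma normal_part_sum m N (A : 'M[R]_(m, N)) k (f : 'I_k -> 'rV[R]_N) :
  normal_part A (\sum_i f i) = \sum_i normal_part A (f i).
Proof. exact: mulmx_suml. Qed.

End Normal.

Section LagrangianSubspace.
Variables (R : realType) (n : nat).

(** The matrix of [Jmul], acting on row vectors. *)
Definition Jmx : 'M[R]_(n + n) := block_mx 0 1%:M (- 1%:M) 0.

Lemma JmulE (z : 'rV[R]_(n + n)) : Jmul z = z *m Jmx.
Proof.
rewrite -[in RHS](hsubmxK z) mul_row_block !mulmx0 mulmx1 mulmxN mulmx1.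
by rewrite add0r addr0.
Qed.

Lemma Jmx_unit : Jmx \in unitmx.
Proof.
have : Jmx *m (- Jmx) = 1%:M.
  rewrite mulmxN mulmx_block !mulmx0 !mul0mx mulmxN mulNmx !mulmx1.
  by rewrite !add0r !addr0 opp_block_mx !opprK oppr0 -scalar_mx_block.
by case/mulmx1_unit.
Qed.

Lemma omegaE (z w : 'rV[R]_(n + n)) : omega z w = (z *m (Jmx *m w^T)) 0 0.
Proof. by rewrite /omega dotE JmulE mulmxA. Qed.

Lemma omegaBl (z z' w : 'rV[R]_(n + n)) :
  omega (z - z') w = omega z w - omega z' w.
Proof. by rewrite !omegaE mulmxBl !mxE. Qed.

Lemma omegaZl c (z w : 'rV[R]_(n + n)) : omega (c *: z) w = c * omega z w.
Proof. by rewrite !omegaE -scalemxAl mxE. Qed.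

Lemma omega_suml k (f : 'I_k -> 'rV[R]_(n + n)) w :
  omega (\sum_i f i) w = \sum_i omega (f i) w.
Proof.
rewrite omegaE mulmx_suml summxE.
by apply: eq_bigr => i _; rewrite omegaE.
Qed.

(** A Lagrangian subspace contains its symplectic orthogonal: both have
    dimension n. *)
Lemma lagrangian_maximal (A : 'M[R]_(n, n + n)) (w : 'rV[R]_(n + n)) :
  row_free A -> (forall i j, omega (row i A) (row j A) = 0) ->
  (forall k, omega w (row k A) = 0) -> (w <= A)%MS.
Proof.
move=> rA AA wA; pose B := Jmx *m A^T.
have omB z k : (z *m B) 0 k = omega z (row k A).
  by rewrite omegaE tr_row colE !mulmxA -colE [RHS]mxE.
have AB : (A <= kermx B)%MS.
  apply/sub_kermxP/row_matrixP => i; rewrite row_mul row0.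
  by apply/rowP => k; rewrite omB AA mxE.
have wB : (w <= kermx B)%MS.
  by apply/sub_kermxP/rowP => k; rewrite omB wA mxE.
apply: submx_trans wB _.
have [_ <-] := mxrank_leqif_sup AB.
have Jf : row_full Jmx by rewrite row_full_unit Jmx_unit.
by rewrite mxrank_ker (eqmxMfull _ Jf) mxrank_tr (eqP rA) addnK.
Qed.

End LagrangianSubspace.

Section BorderedMetric.
Variables (R : realType) (n : nat).
Variables (Xi : 'M[R]_n) (sigma : 'cV[R]_n) (x w : 'rV[R]_n) (c : R).
Hypotheses (hw : forall l, 0 < w 0 l) (hc : 0 < c).
Hypotheses (x_neq0 : x != 0) (hx : Xi *m x^T = 0).
Hypothesis inj : forall v : 'rV[R]_n, v *m Xi = 0 -> v *m sigma = 0 -> v = 0.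

(** The square of the norm of [x] for the inverse weights, and the vector dual
    to [x]. *)
Definition wnorm : R := \sum_l x 0 l ^+ 2 / w 0 l.
Definition wdual : 'rV[R]_n := \row_l (x 0 l / w 0 l).

(** The Gram matrix of the vectors [(Xi_i, sigma_i)] for the ambient form
    [diag(w) + c]. *)
Definition gram : 'M[R]_n :=
  Xi *m diag_mx w *m Xi^T + c *: (sigma *m sigma^T).

Local Notation D := (diag_mx w).
Local Notation D' := (diag_mx (\row_l (w 0 l)^-1)).

Lemma weighted_norm_gt0 : 0 < wnorm.
Proof.
have A0 l : 0 <= x 0 l ^+ 2 / w 0 l by rewrite divr_ge0 ?sqr_ge0// ltW.
rewrite lt_neqAle sumr_ge0// andbT eq_sym psumr_eq0//.
apply: contraNN x_neq0 => /allP x0; apply/eqP/rowP => l; rewrite mxE.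
have := x0 l (mem_index_enum l); rewrite /= mulf_eq0 invr_eq0 (gt_eqF (hw l)).
by rewrite orbF sqrf_eq0 => /eqP.
Qed.

Let yx : wdual *m x^T = wnorm%:M.
Proof.
apply/matrixP => i j; rewrite !ord1 !mxE eqxx; apply: eq_bigr => l _.
by rewrite !mxE mulrAC -expr2.
Qed.

Let yD : wdual *m D = x.
Proof.
apply/rowP => l; rewrite mul_mx_diag !mxE divfK//.
by rewrite gt_eqF.
Qed.

(** The frame of the tangent vectors [(Xi_i, sigma_i)], bordered by the vector
    [(wdual, 0)], which is orthogonal to them for the ambient form
    [diag(w) + c]. *)
Let B : 'M[R]_(n + 1) := block_mx Xi sigma wdual 0.
Let N : 'M[R]_(n + 1) := block_mx D 0 0 c%:M.

Let BNB : B *m N *m B^T = block_mx gram 0 0 wnorm%:M.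
Proof.
rewrite tr_block_mx !mulmx_block !mulmx0 !mul0mx !addr0 !add0r yD trmx0 !mulmx0.
rewrite !addr0.
have xXi : x *m Xi^T = 0 by rewrite -[x]trmxK -trmx_mul hx trmx0.
have XiDy : Xi *m D *m wdual^T = 0.
  by rewrite -mulmxA -[D]tr_diag_mx -trmx_mul yD.
have xy : x *m wdual^T = wnorm%:M.
  by rewrite -[x]trmxK -trmx_mul yx tr_scalar_mx.
by rewrite xXi XiDy xy mul_mx_scalar -scalemxAl mul0mx addr0.
Qed.

Let B_unit : B \in unitmx.
Proof.
rewrite -row_free_unit; apply/inj_row_free => v.
rewrite -[v]hsubmxK mul_row_block mulmx0 addr0.
set v1 := lsubmx v; set v2 := rsubmx v.
rewrite -[X in _ = X]row_mx0 => /eq_row_mx[e1 e2].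
have v20 : v2 = 0.
  have := congr1 (mulmx^~ x^T) e1.
  rewrite mulmxDl -!mulmxA hx mulmx0 add0r yx mul0mx mul_mx_scalar => /eqP.
  by rewrite scaler_eq0 (gt_eqF weighted_norm_gt0) => /eqP.
move: e1; rewrite v20 mul0mx addr0 => e1.
by rewrite (inj e1 e2) row_mx0.
Qed.

Let N_inv : N *m block_mx D' 0 0 (c^-1)%:M = 1%:M.
Proof.
rewrite mulmx_block !mulmx0 !mul0mx !addr0 !add0r -scalar_mxM divff ?gt_eqF//.
rewrite (_ : D *m D' = 1%:M) -?scalar_mx_block//.
apply/matrixP => i j; rewrite mul_diag_mx !mxE.
by case: eqP => [->|]; rewrite ?mulr0// mulr1n divff// gt_eqF.
Qed.

Lemma metric_unit : gram \in unitmx.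
Proof.
have uN : N \in unitmx by have [] := mulmx1_unit N_inv.
have : block_mx gram 0 0 (wnorm%:M : 'M[R]_1) \in unitmx.
  by rewrite -BNB !unitmx_mul unitmx_tr B_unit uN.
by rewrite !unitmxE det_ublock unitrM => /andP[].
Qed.

(** The contractions of the inverse Gram matrix with the frame. With [B] the
    bordered frame and [N] the ambient form, [B *m N *m B^T] is block diagonal,
    and [B^T *m invmx (B *m N *m B^T) *m B = invmx N] because [B] is
    invertible; these are the blocks of that identity. *)
Lemma inverse_metric :
  [/\ Xi^T *m invmx gram *m Xi = D' - wnorm^-1 *: (wdual^T *m wdual),
      Xi^T *m invmx gram *m sigma = 0,
      sigma^T *m invmx gram *m Xi = 0
    & sigma^T *m invmx gram *m sigma = (c^-1)%:M].
Proof.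
have A0 : wnorm != 0 by rewrite gt_eqF ?weighted_norm_gt0.
have [uN _] := mulmx1_unit N_inv.
pose Gi : 'M[R]_(n + 1) := block_mx (invmx gram) 0 0 (wnorm^-1)%:M.
have GGi : block_mx gram 0 0 (wnorm%:M : 'M[R]_1) *m Gi = 1%:M.
  rewrite mulmx_block !mulmx0 !mul0mx !addr0 !add0r -scalar_mxM divff//.
  by rewrite mulmxV ?metric_unit// -scalar_mx_block.
have key : B^T *m Gi *m B = block_mx D' 0 0 (c^-1)%:M.
  have e1 : N *m (B^T *m (Gi *m B)) = 1%:M.
    have : B *m (N *m (B^T *m Gi)) = 1%:M by rewrite !mulmxA BNB.
    by move=> /mulmx1C; rewrite -!mulmxA.
  rewrite -mulmxA; have := congr1 (mulmx (invmx N)) e1.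
  rewrite mulKmx// mulmx1 => ->.
  by have := congr1 (mulmx (invmx N)) N_inv; rewrite mulKmx// mulmx1.
move: key; rewrite /Gi /B tr_block_mx trmx0 !mulmx_block.
rewrite !mulmx0 !mul0mx !addr0 !add0r mul_mx_scalar -scalemxAl.
move=> /eq_block_mx[e1 e2 e3 e4]; split=> //.
  by rewrite -e1 addrK.
by rewrite -e3 mul0mx addr0.
Qed.

End BorderedMetric.

(** * The pointwise algebra of the immersion *)

Section Pointwise.
Variables (R : realType) (n : nat) (a psi : 'I_n -> R) (E alpha : R).
Hypotheses (ha : forall j, 0 < a j) (hE : 1 < E) (halpha : 0 <= alpha).

Local Notation r := (Defs.rad a).
Local Notation L := (slope a E alpha).
Local Notation L' := (slope' a E alpha).
Local Notation re := (re_profile a psi E alpha).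
Local Notation im := (im_profile a psi E alpha).
Local Notation re1 := (re_profile1 a psi E alpha).
Local Notation im1 := (im_profile1 a psi E alpha).
Local Notation re2 := (re_profile2 a psi E alpha).
Local Notation im2 := (im_profile2 a psi E alpha).

Variables (t : R) (x : 'rV[R]_n).

(** The image under the differential of the immersion at [(x, t)] of the
    vector [(xi, sigma)]. *)
Definition push (xi : 'rV[R]_n) (sigma : R) : 'rV[R]_(n + n) :=
  row_mx (\row_l (xi 0 l * re l t + x 0 l * (re1 l t * sigma)))
         (\row_l (xi 0 l * im l t + x 0 l * (im1 l t * sigma))).

(** The second derivative of the immersion along a surface in its domain with
    first derivatives [(xi, sigma)], [(eta, tau)] and mixed second derivative
    [(zeta, rho)]. *)
Definition push2 (xi : 'rV[R]_n) (sigma : R) (eta : 'rV[R]_n) (tau : R)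
    (zeta : 'rV[R]_n) (rho : R) : 'rV[R]_(n + n) :=
  row_mx
    (\row_l ((zeta 0 l * re l t + eta 0 l * (re1 l t * sigma)) +
             (xi 0 l * (re1 l t * tau) +
              x 0 l * ((re2 l t * sigma) * tau + re1 l t * rho))))
    (\row_l ((zeta 0 l * im l t + eta 0 l * (im1 l t * sigma)) +
             (xi 0 l * (im1 l t * tau) +
              x 0 l * ((im2 l t * sigma) * tau + im1 l t * rho)))).

Lemma dot_row_mx (p q p' q' : 'rV[R]_n) :
  dot (row_mx p q) (row_mx p' q') = \sum_l (p 0 l * p' 0 l + q 0 l * q' 0 l).
Proof.
rewrite /dot big_split_ord big_split /=; congr (_ + _); apply: eq_bigr => l _.
  by rewrite !row_mxEl.
by rewrite !row_mxEr.
Qed.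

Lemma omega_row_mx (p q p' q' : 'rV[R]_n) :
  omega (row_mx p q) (row_mx p' q') = \sum_l (p 0 l * q' 0 l - q 0 l * p' 0 l).
Proof.
rewrite /omega /Jmul row_mxKl row_mxKr dot_row_mx; apply: eq_bigr => l _.
by rewrite mxE addrC mulNr.
Qed.

(** Invariance of the area form and of the scalar product of the plane under a
    rotation. *)
Lemma rotation_area (c s p q p' q' : R) : c ^+ 2 + s ^+ 2 = 1 ->
  (c * p - s * q) * (s * p' + c * q') - (s * p + c * q) * (c * p' - s * q') =
  p * q' - q * p'.
Proof.
move=> cs; transitivity ((c ^+ 2 + s ^+ 2) * (p * q' - q * p')); first by ring.
by rewrite cs mul1r.
Qed.

Lemma rotation_dot (c s p q p' q' : R) : c ^+ 2 + s ^+ 2 = 1 ->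
  (c * p - s * q) * (c * p' - s * q') + (s * p + c * q) * (s * p' + c * q') =
  p * p' + q * q'.
Proof.
move=> cs; transitivity ((c ^+ 2 + s ^+ 2) * (p * p' + q * q')); first by ring.
by rewrite cs mul1r.
Qed.

(** The components of [push] and [push2] are complex numbers multiplied by
    [e^(i * phi_l)]. *)
Lemma re_pushE l xi y sigma :
  xi * re l t + y * (re1 l t * sigma) =
  cos (phase a psi E alpha l t) * (xi * r l t + y * sigma * t / r l t) -
  sin (phase a psi E alpha l t) * (y * sigma * L t / r l t).
Proof.
rewrite /re_profile /re_profile1; have := rad_neq0 ha l t.
move: (cos _) (sin _) (L t) (r l t) => c s m q q0.
by field.
Qed.

Lemma im_pushE l xi y sigma :
  xi * im l t + y * (im1 l t * sigma) =
  sin (phase a psi E alpha l t) * (xi * r l t + y * sigma * t / r l t) +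
  cos (phase a psi E alpha l t) * (y * sigma * L t / r l t).
Proof.
rewrite /im_profile /im_profile1; have := rad_neq0 ha l t.
move: (cos _) (sin _) (L t) (r l t) => c s m q q0.
by field.
Qed.

Lemma re_push2E l xi y sigma eta tau zeta rho :
  zeta * re l t + eta * (re1 l t * sigma) +
    (xi * (re1 l t * tau) + y * ((re2 l t * sigma) * tau + re1 l t * rho)) =
  cos (phase a psi E alpha l t) *
    (zeta * r l t + (eta * sigma + xi * tau + y * rho) * t / r l t +
     y * sigma * tau * accel a E alpha l t) -
  sin (phase a psi E alpha l t) *
    ((eta * sigma + xi * tau + y * rho) * L t / r l t +
     y * sigma * tau * L' t / r l t).
Proof.
rewrite /re_profile /re_profile1 /re_profile2; have := rad_neq0 ha l t.
move: (cos _) (sin _) (L t) (L' t) (r l t) (accel _ _ _ _ _) => c s m m' q k q0.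
by field.
Qed.

Lemma im_push2E l xi y sigma eta tau zeta rho :
  zeta * im l t + eta * (im1 l t * sigma) +
    (xi * (im1 l t * tau) + y * ((im2 l t * sigma) * tau + im1 l t * rho)) =
  sin (phase a psi E alpha l t) *
    (zeta * r l t + (eta * sigma + xi * tau + y * rho) * t / r l t +
     y * sigma * tau * accel a E alpha l t) +
  cos (phase a psi E alpha l t) *
    ((eta * sigma + xi * tau + y * rho) * L t / r l t +
     y * sigma * tau * L' t / r l t).
Proof.
rewrite /im_profile /im_profile1 /im_profile2; have := rad_neq0 ha l t.
move: (cos _) (sin _) (L t) (L' t) (r l t) (accel _ _ _ _ _) => c s m m' q k q0.
by field.
Qed.

Lemma omega_push xi sigma eta tau :
  omega (push xi sigma) (push eta tau) =
  L t * (tau * dot x xi - sigma * dot x eta).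
Proof.
rewrite omega_row_mx mulrBr !mulr_sumr -sumrB; apply: eq_bigr => l _.
rewrite !mxE !re_pushE !im_pushE rotation_area ?cos2Dsin2//.
by have := rad_neq0 ha l t; move: (L t) (r l t) => m q q0; field.
Qed.

(** The induced metric in the sphere directions. *)
Definition weights : 'rV[R]_n := \row_l r l t ^+ 2.

Lemma dot_push xi sigma eta tau : dot x xi = 0 -> dot x eta = 0 ->
  dot (push xi sigma) (push eta tau) =
  \sum_l weights 0 l * (xi 0 l * eta 0 l) +
  (t ^+ 2 + L t ^+ 2) * wnorm x weights * (sigma * tau).
Proof.
move=> xx xe; rewrite dot_row_mx.
have -> : \sum_l weights 0 l * (xi 0 l * eta 0 l) =
  \sum_l weights 0 l * (xi 0 l * eta 0 l) +
  t * tau * dot x xi + t * sigma * dot x eta.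
  by rewrite xx xe !mulr0 !addr0.
rewrite /wnorm mulr_sumr mulr_suml !mulr_sumr -!big_split; apply: eq_bigr => l _.
rewrite /= !mxE !re_pushE !im_pushE rotation_dot ?cos2Dsin2//.
by have := rad_neq0 ha l t; move: (L t) (r l t) => m q q0; field.
Qed.

(** Once [dot x zeta] is replaced by [- dot xi eta], which is the second
    derivative of the equation of the sphere, this trilinear form is symmetric
    in the three tangent vectors, as the second fundamental form of a Lagrangian
    submanifold has to be. *)
Lemma omega_push2 xi sigma eta tau zeta rho theta kappa :
  dot x theta = 0 ->
  omega (push2 xi sigma eta tau zeta rho) (push theta kappa) =
  L t * (kappa * dot x zeta - sigma * dot eta theta - tau * dot xi theta) -
  sigma * tau * kappa *
    ((t * L' t - L t) * wnorm x weights +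
     (t ^+ 2 + L t ^+ 2) * L t * dot (wdual x weights) (wdual x weights)).
Proof.
move=> xt; rewrite omega_row_mx.
rewrite [LHS](_ : _ = L t * (kappa * dot x zeta - sigma * dot eta theta -
    tau * dot xi theta) - (L t * rho + sigma * tau * L' t) * dot x theta -
  sigma * tau * kappa *
    ((t * L' t - L t) * wnorm x weights +
     (t ^+ 2 + L t ^+ 2) * L t * dot (wdual x weights) (wdual x weights))).
  by rewrite xt mulr0 subr0.
rewrite /wnorm /dot !mulr_sumr -big_split /= !mulr_sumr -!sumrB.
rewrite mulr_sumr -!sumrB.
apply: eq_bigr => l _.
rewrite !mxE re_push2E im_push2E re_pushE im_pushE rotation_area ?cos2Dsin2//.
rewrite /accel.
by have := rad_neq0 ha l t; move: (L t) (L' t) (r l t) => m m' q q0; field.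
Qed.

Lemma push_inj xi sigma : x != 0 -> t != 0 -> push xi sigma = 0 ->
  xi = 0 /\ sigma = 0.
Proof.
move=> x0 t0 P0.
have H l : xi 0 l * r l t + x 0 l * sigma * t / r l t = 0 /\
    x 0 l * sigma * L t / r l t = 0.
  have e1 : xi 0 l * re l t + x 0 l * (re1 l t * sigma) = 0.
    have := congr1 (fun M : 'rV[R]_(n + n) => M 0 (lshift n l)) P0.
    by rewrite row_mxEl !mxE.
  have e2 : xi 0 l * im l t + x 0 l * (im1 l t * sigma) = 0.
    have := congr1 (fun M : 'rV[R]_(n + n) => M 0 (rshift n l)) P0.
    by rewrite row_mxEr !mxE.
  move: e1 e2; rewrite re_pushE im_pushE.
  set p := xi 0 l * r l t + _; set q := x 0 l * sigma * L t / _.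
  move: (cos2Dsin2 (phase a psi E alpha l t)).
  move: (cos _) (sin _) => c s cs e1 e2; split.
    transitivity ((c ^+ 2 + s ^+ 2) * p); first by rewrite cs mul1r.
    transitivity (c * (c * p - s * q) + s * (s * p + c * q)); first by ring.
    by rewrite e1 e2 !mulr0 addr0.
  transitivity ((c ^+ 2 + s ^+ 2) * q); first by rewrite cs mul1r.
  transitivity (c * (s * p + c * q) - s * (c * p - s * q)); first by ring.
  by rewrite e1 e2 !mulr0 subrr.
have s0 : sigma = 0.
  have /rV0Pn[l xl] := x0.
  have [_] := H l; have := rad_neq0 ha l t.
  have := slope_neq0 ha hE halpha t0; move: xl.
  move: (L t) (r l t) (x 0 l) => m q y y0 m0 q0 /eqP.
  rewrite !mulf_eq0 invr_eq0 (negbTE y0) (negbTE m0) (negbTE q0) !orbF.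
  by move/eqP.
split=> //; apply/rowP => l; rewrite mxE.
have [+ _] := H l; rewrite s0 mulr0 !mul0r addr0 => /eqP.
by rewrite mulf_eq0 (negbTE (rad_neq0 ha l t)) orbF => /eqP.
Qed.

End Pointwise.

Section Trace.
Variables (R : realType) (n : nat) (a psi : 'I_n -> R) (E alpha : R).
Hypotheses (ha : forall j, 0 < a j) (hE : 1 < E) (halpha : 0 <= alpha).

Local Notation L := (slope a E alpha).
Local Notation L' := (slope' a E alpha).

Variables (t : R) (x : 'rV[R]_n) (Xi : 'M[R]_n) (sigma : 'cV[R]_n).
Hypotheses (t_neq0 : t != 0) (x_sphere : dot x x = 1).
Hypothesis tangent : forall i, dot x (row i Xi) = 0.
Hypothesis inj : forall v : 'rV[R]_n, v *m Xi = 0 -> v *m sigma = 0 -> v = 0.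

Local Notation w := (weights a t).

(** The squared length of the image of the vector [(0, 1)]. *)
Definition axis_norm : R := (t ^+ 2 + L t ^+ 2) * wnorm x w.

Local Notation G := (gram Xi sigma w axis_norm).

Lemma sphere_neq0 : x != 0.
Proof.
apply: contra_eq_neq x_sphere => ->.
by rewrite /dot big1 ?(eq_sym 0) ?oner_neq0// => l _; rewrite mxE mul0r.
Qed.

Lemma weights_gt0 l : 0 < w 0 l.
Proof. by rewrite mxE exprn_gt0// rad_gt0. Qed.

Lemma speed_gt0 : 0 < t ^+ 2 + L t ^+ 2.
Proof. by rewrite ltr_pwDl ?sqr_ge0// exprn_even_gt0. Qed.

Lemma axis_norm_gt0 : 0 < axis_norm.
Proof.
apply: mulr_gt0; first exact: speed_gt0.
by apply: weighted_norm_gt0; [exact: weights_gt0|exact: sphere_neq0].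
Qed.

Lemma tangentE : Xi *m x^T = 0.
Proof.
apply/colP => i; rewrite !mxE -[RHS](tangent i); apply: eq_bigr => l _.
by rewrite !mxE mulrC.
Qed.

(** Entries of a congruence as contractions with [M]. *)
Lemma congruenceE m p q (P : 'M[R]_(m, p)) (Q : 'M[R]_(m, q)) (M : 'M[R]_m)
    i j :
  (P^T *m M *m Q) i j = \sum_k \sum_l M k l * (P k i * Q l j).
Proof.
rewrite mxE exchange_big; apply: eq_bigr => l _; rewrite mxE mulr_suml.
by apply: eq_bigr => k _; rewrite !mxE mulrA [P k i * _]mulrC.
Qed.

(** The trace of the second fundamental form: by [inverse_metric], only the
    scalar products of two sphere directions and the product of the two
    components along the real factor contribute, and these contributions add up
    to the multiple [alpha] by the differential equation satisfied by
    [slope]. *)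
Lemma trace_omega (zeta : 'I_n -> 'I_n -> 'rV[R]_n) (rho : 'I_n -> 'I_n -> R)
    (theta : 'rV[R]_n) (kappa : R) :
  (forall i j, dot x (zeta i j) = - dot (row i Xi) (row j Xi)) ->
  dot x theta = 0 ->
  \sum_i \sum_j invmx G i j *
    omega (push2 a psi E alpha t x (row i Xi) (sigma i 0) (row j Xi) (sigma j 0)
             (zeta i j) (rho i j)) (push a psi E alpha t x theta kappa) =
  alpha * omega (push a psi E alpha t x x 0) (push a psi E alpha t x theta kappa).
Proof.
move=> hz xt.
have [e1 e2 e3 e4] := inverse_metric weights_gt0 axis_norm_gt0 sphere_neq0
  tangentE inj.
set K := (t * L' t - L t) * wnorm x w +
  (t ^+ 2 + L t ^+ 2) * L t * dot (wdual x w) (wdual x w).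
(* Traces of the four types of terms of [omega_push2]: sphere directions, mixed
   terms, which vanish, and the real factor. *)
have T1 : \sum_i \sum_j invmx G i j * dot (row i Xi) (row j Xi) =
    \sum_l (w 0 l)^-1 - (wnorm x w)^-1 * dot (wdual x w) (wdual x w).
  have -> : \sum_i \sum_j invmx G i j * dot (row i Xi) (row j Xi) =
      \sum_l (Xi^T *m invmx G *m Xi) l l.
    under [RHS]eq_bigr do rewrite congruenceE.
    rewrite [RHS]exchange_big /=; apply: eq_bigr => i _.
    rewrite [RHS]exchange_big /=; apply: eq_bigr => j _.
    by rewrite -mulr_sumr; congr (_ * _); apply: eq_bigr => l _; rewrite !mxE.
  rewrite e1 mulr_sumr -sumrB; apply: eq_bigr => l _.
  by rewrite !mxE eqxx big_ord1 !mxE.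
have T2 : \sum_i \sum_j invmx G i j * (sigma i 0 * dot (row j Xi) theta) = 0.
  have -> : \sum_i \sum_j invmx G i j * (sigma i 0 * dot (row j Xi) theta) =
      \sum_l (sigma^T *m invmx G *m Xi) 0 l * theta 0 l.
    under [RHS]eq_bigr do rewrite congruenceE mulr_suml.
    rewrite [RHS]exchange_big /=; apply: eq_bigr => i _.
    under [RHS]eq_bigr do rewrite mulr_suml.
    rewrite [RHS]exchange_big /=; apply: eq_bigr => j _.
    rewrite mulrA mulr_sumr; apply: eq_bigr => l _.
    by rewrite !mxE !mulrA.
  by rewrite e3 big1// => l _; rewrite mxE mul0r.
have T3 : \sum_i \sum_j invmx G i j * (sigma j 0 * dot (row i Xi) theta) = 0.
  have -> : \sum_i \sum_j invmx G i j * (sigma j 0 * dot (row i Xi) theta) =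
      \sum_l (Xi^T *m invmx G *m sigma) l 0 * theta 0 l.
    under [RHS]eq_bigr do rewrite congruenceE mulr_suml.
    rewrite [RHS]exchange_big /=; apply: eq_bigr => i _.
    under [RHS]eq_bigr do rewrite mulr_suml.
    rewrite [RHS]exchange_big /=; apply: eq_bigr => j _.
    rewrite mulrA mulr_sumr; apply: eq_bigr => l _.
    by rewrite !mxE; ring.
  by rewrite e2 big1// => l _; rewrite mxE mul0r.
have T4 : \sum_i \sum_j invmx G i j * (sigma i 0 * sigma j 0) = axis_norm^-1.
  by rewrite -congruenceE e4 mxE eqxx.
have -> : \sum_i \sum_j invmx G i j *
    omega (push2 a psi E alpha t x (row i Xi) (sigma i 0) (row j Xi) (sigma j 0)
             (zeta i j) (rho i j)) (push a psi E alpha t x theta kappa) =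
  - (L t * kappa) * \sum_i \sum_j invmx G i j * dot (row i Xi) (row j Xi) -
  L t * \sum_i \sum_j invmx G i j * (sigma i 0 * dot (row j Xi) theta) -
  L t * \sum_i \sum_j invmx G i j * (sigma j 0 * dot (row i Xi) theta) -
  kappa * K * \sum_i \sum_j invmx G i j * (sigma i 0 * sigma j 0).
  rewrite !mulr_sumr -!sumrB; apply: eq_bigr => i _.
  rewrite !mulr_sumr -!sumrB; apply: eq_bigr => j _.
  by rewrite omega_push2// hz -/K; ring.
rewrite T1 T2 T3 T4 omega_push// xt x_sphere /axis_norm /K.
(* The differential equation satisfied by [slope]. *)
have hL : t * L' t - L t = - ((t ^+ 2 + L t ^+ 2) * L t *
    (\sum_l (w 0 l)^-1 + alpha)).
  rewrite /slope' mulrC divfK//.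
  have -> : \sum_l (w 0 l)^-1 = \sum_l (Defs.rad a l t ^+ 2)^-1.
    by apply: eq_bigr => l _; rewrite mxE.
  by ring.
have s0 := lt0r_neq0 speed_gt0.
have w0 : wnorm x w != 0.
  rewrite gt_eqF//.
  by apply: weighted_norm_gt0; [exact: weights_gt0|exact: sphere_neq0].
rewrite hL; move: (t ^+ 2 + _) s0 (wnorm _ _) w0 (\sum_l _) => p p0 q q0 s.
by field; apply/andP.
Qed.

End Trace.

(** * The immersion in local coordinates *)

Section LocalCoordinates.
Variables (R : realType) (n : nat) (a psi : 'I_n -> R) (E alpha : R).
Hypotheses (ha : forall j, 0 < a j) (hE : 1 < E) (halpha : 0 <= alpha).
Variables (U : set 'rV[R]_n) (kappa : 'rV[R]_n -> 'rV[R]_n * R).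
Hypothesis hk : local_param (Ldomain R n) U kappa.

Local Notation F := (Lparam a psi E alpha \o kappa).
Local Notation x := (fun u => (kappa u).1).
Local Notation s := (fun u => (kappa u).2).

Let oU : open U. Proof. by case: hk. Qed.
Let sk : smooth_on U kappa. Proof. by case: hk. Qed.
Let sx : smooth_on U x. Proof. exact: smooth_fst. Qed.
Let ss : smooth_on U s. Proof. exact: smooth_snd. Qed.

Lemma local_param_in u : U u -> dot (x u) (x u) = 1 /\ s u != 0.
Proof.
move=> Uu; have [_ _ _ [Q _ kQ] _] := hk.
have [[x1 s0] _] : (Ldomain R n `&` Q) (kappa u) by rewrite -kQ; exists u.
by split=> //; rewrite -[RHS]x1; apply: eq_bigr => l _; rewrite expr2.
Qed.

Lemma smooth_is_derive (V W : normedModType R) (O : set V) (f : V -> W) u v :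
  smooth_on O f -> O u -> is_derive u v f ('D_v f u).
Proof.
move=> sf Ou; apply: derivableP; apply: diff_derivable.
exact: smooth_differentiable sf Ou.
Qed.

Lemma derive_coord (V : normedModType R) m (O : set V) (f : V -> 'rV[R]_m)
    u v j :
  smooth_on O f -> O u -> 'D_v (fun u => f u 0 j) u = ('D_v f u) 0 j.
Proof.
move=> sf Ou; apply: (@derive_linear _ _ _ _ (fun y : 'rV[R]_m => y 0 j)).
- exact: linear_rVcoord.
- exact: coord_continuous.
- exact: smooth_differentiable sf Ou.
Qed.

Lemma derive_fst u v : U u -> 'D_v x u = ('D_v kappa u).1.
Proof.
move=> Uu; apply: (@derive_linear _ _ _ _ fst) => //.
  exact: continuous_fst.
exact: smooth_differentiable sk Uu.
Qed.

Lemma derive_snd u v : U u -> 'D_v s u = ('D_v kappa u).2.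
Proof.
move=> Uu; apply: (@derive_linear _ _ _ _ snd) => //.
  exact: continuous_snd.
exact: smooth_differentiable sk Uu.
Qed.

(** Formally, the position vector is the image of the radial vector [(x, 0)]. *)
Lemma Lpoint_push y t : Lpoint a psi E alpha y t = push a psi E alpha t y y 0.
Proof.
by congr row_mx; apply/rowP => k; rewrite !mxE !mulr0 addr0 mulrA.
Qed.

Lemma smooth_immersion : smooth_on U F.
Proof.
apply: smooth_rV => // j.
have [k ->|k ->] := split_ordP j.
  apply: (@smooth_eq _ _ _ _ (fun u => x u 0 k *
    re_profile a psi E alpha k (s u))) => //.
    by move=> u _; rewrite /= /Lparam /Lpoint row_mxEl mxE mulrA.
  apply: smooth_mul => //; first exact: smooth_coord.
  have [sr _] := smooth_profile psi ha hE halpha k.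
  apply: (@smooth_comp1 _ _ _ _ s _ oU _ sr ss) => u Uu.
  by have [_] := local_param_in Uu.
apply: (@smooth_eq _ _ _ _ (fun u => x u 0 k *
  im_profile a psi E alpha k (s u))) => //.
  by move=> u _; rewrite /= /Lparam /Lpoint row_mxEr mxE mulrA.
apply: smooth_mul => //; first exact: smooth_coord.
have [_ si] := smooth_profile psi ha hE halpha k.
apply: (@smooth_comp1 _ _ _ _ s _ oU _ si ss) => u Uu.
by have [_] := local_param_in Uu.
Qed.

Lemma derive_immersion u v : U u ->
  'D_v F u = push a psi E alpha (s u) (x u) ('D_v x u) ('D_v s u).
Proof.
move=> Uu; apply/rowP => j; rewrite -(derive_coord _ _ smooth_immersion)//.
have dx k := smooth_is_derive v (smooth_coord k oU sx) Uu.
have ds := smooth_is_derive v ss Uu.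
have dds := smooth_differentiable ss Uu.
have [k ->|k ->] := split_ordP j.
  rewrite (_ : (fun u => _) = (fun u => x u 0 k *
    re_profile a psi E alpha k (s u))); last first.
    by apply/funext => y; rewrite /= /Lparam /Lpoint row_mxEl mxE mulrA.
  have dr := is_derive_re_profile psi ha hE halpha k (s u).
  have [_ ->] := is_derive_mul (dx k) (is_derive_comp1 dds ds dr).
  by rewrite row_mxEl mxE (derive_coord _ _ sx).
rewrite (_ : (fun u => _) = (fun u => x u 0 k *
  im_profile a psi E alpha k (s u))); last first.
  by apply/funext => y; rewrite /= /Lparam /Lpoint row_mxEr mxE mulrA.
have dr := is_derive_im_profile psi ha hE halpha k (s u).
have [_ ->] := is_derive_mul (dx k) (is_derive_comp1 dds ds dr).
by rewrite row_mxEr mxE (derive_coord _ _ sx).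
Qed.

Lemma derive2_immersion u v z : U u ->
  'D_z ('D_v F) u = push2 a psi E alpha (s u) (x u)
    ('D_z x u) ('D_z s u) ('D_v x u) ('D_v s u)
    ('D_z ('D_v x) u) ('D_z ('D_v s) u).
Proof.
move=> Uu; have [_ s0] := local_param_in Uu.
have sdx := smooth_derive v sx; have sds := smooth_derive v ss.
apply/rowP => j.
rewrite -(derive_coord _ _ (smooth_derive v smooth_immersion))//.
rewrite (derive_eq_on (g := fun u => push a psi E alpha (s u) (x u)
  ('D_v x u) ('D_v s u) 0 j) _ oU)//; last first.
  by move=> y Uy; rewrite derive_immersion.
have dx k := smooth_is_derive z (smooth_coord k oU sx) Uu.
have ddx k := smooth_is_derive z (smooth_coord k oU sdx) Uu.
have ds := smooth_is_derive z ss Uu.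
have dds := smooth_is_derive z sds Uu.
have fs := smooth_differentiable ss Uu.
have [k ->|k ->] := split_ordP j.
  rewrite (_ : (fun u => _) = (fun u =>
    ('D_v x u) 0 k * re_profile a psi E alpha k (s u) +
    x u 0 k * (re_profile1 a psi E alpha k (s u) * 'D_v s u))); last first.
    by apply/funext => y; rewrite row_mxEl mxE.
  have d1 := is_derive_comp1 fs ds
    (is_derive_re_profile psi ha hE halpha k (s u)).
  have d2 := is_derive_comp1 fs ds
    (is_derive_re_profile1 psi ha hE halpha k s0).
  have [_ ->] := is_derive_add (is_derive_mul (ddx k) d1)
    (is_derive_mul (dx k) (is_derive_mul d2 dds)).
  by rewrite row_mxEl mxE (derive_coord _ _ sx)// (derive_coord _ _ sdx).
rewrite (_ : (fun u => _) = (fun u =>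
  ('D_v x u) 0 k * im_profile a psi E alpha k (s u) +
  x u 0 k * (im_profile1 a psi E alpha k (s u) * 'D_v s u))); last first.
  by apply/funext => y; rewrite row_mxEr mxE.
have d1 := is_derive_comp1 fs ds
  (is_derive_im_profile psi ha hE halpha k (s u)).
have d2 := is_derive_comp1 fs ds
  (is_derive_im_profile1 psi ha hE halpha k s0).
have [_ ->] := is_derive_add (is_derive_mul (ddx k) d1)
  (is_derive_mul (dx k) (is_derive_mul d2 dds)).
by rewrite row_mxEr mxE (derive_coord _ _ sx)// (derive_coord _ _ sdx).
Qed.

Lemma derive_dot (f g : 'rV[R]_n -> 'rV[R]_n) u v :
  smooth_on U f -> smooth_on U g -> U u ->
  'D_v (fun u => dot (f u) (g u)) u =
  dot ('D_v f u) (g u) + dot (f u) ('D_v g u).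
Proof.
move=> sf sg Uu.
rewrite (_ : (fun u => _) = \sum_l (fun u => f u 0 l * g u 0 l)); last first.
  by apply/funext => y; rewrite fct_sumE.
rewrite derive_sum; last first.
  move=> l; apply: diff_derivable; apply: smooth_differentiable Uu.
  by apply: smooth_mul => //; exact: smooth_coord.
rewrite /dot -big_split; apply: eq_bigr => l _ /=.
have df := smooth_is_derive v (smooth_coord l oU sf) Uu.
have dg := smooth_is_derive v (smooth_coord l oU sg) Uu.
have [_ ->] := is_derive_mul df dg.
by rewrite (derive_coord _ _ sf)// (derive_coord _ _ sg).
Qed.

Lemma dotC (y z : 'rV[R]_n) : dot y z = dot z y.
Proof. by apply: eq_bigr => l _; rewrite mulrC. Qed.

(** First and second derivatives of the equation of the sphere along a
    parametrization. *)
Lemma sphere_tangent u v : U u -> dot (x u) ('D_v x u) = 0.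
Proof.
move=> Uu; have := derive_dot v sx sx Uu.
rewrite (derive_eq_on (g := fun=> 1 : R) _ oU)//; last first.
  by move=> y Uy; have [] := local_param_in Uy.
rewrite derive_cst [dot ('D_v _ _) _]dotC -mulr2n => /esym/eqP.
by rewrite mulrn_eq0 => /eqP.
Qed.

Lemma sphere_tangent2 u v z : U u ->
  dot (x u) ('D_z ('D_v x) u) = - dot ('D_z x u) ('D_v x u).
Proof.
move=> Uu; have := derive_dot z sx (smooth_derive v sx) Uu.
rewrite (derive_eq_on (g := fun=> 0 : R) _ oU)//; last first.
  by move=> y Uy; exact: sphere_tangent.
by rewrite derive_cst => /esym/eqP; rewrite addrC addr_eq0 => /eqP.
Qed.

Lemma immersion_inj u : U u -> injective ('d F u).
Proof.
move=> Uu; have dF := smooth_differentiable smooth_immersion Uu.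
have dk := smooth_differentiable sk Uu.
have [x1 s0] := local_param_in Uu.
have [_ _ ik _ _] := hk.
move=> v w /eqP; rewrite -subr_eq0 -linearB /= -deriveE// derive_immersion//.
move=> /eqP /(push_inj ha hE halpha (sphere_neq0 x1) s0)[].
rewrite derive_fst// derive_snd// => k1 k2; apply/eqP; rewrite -subr_eq0.
apply/eqP; apply: (ik u Uu); rewrite linear0 -deriveE//.
by rewrite [LHS]surjective_pairing k1 k2.
Qed.

Lemma immersion_omega u v w : U u -> omega ('d F u v) ('d F u w) = 0.
Proof.
move=> Uu; have dF := smooth_differentiable smooth_immersion Uu.
rewrite -!deriveE// !derive_immersion// omega_push//.
by rewrite !sphere_tangent// !mulr0 subrr mulr0.
Qed.

Lemma mean_curvature_immersion u : U u ->
  mean_curvature F u =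
  alpha *: normal_part ('J F u) (Lparam a psi E alpha (kappa u)).
Proof.
move=> Uu; have dF := smooth_differentiable smooth_immersion Uu.
have [x1 s0] := local_param_in Uu.
pose e i : 'rV[R]_n := delta_mx 0 i.
pose Xi : 'M[R]_n := \matrix_(i, l) ('D_(e i) x u) 0 l.
pose sigma : 'cV[R]_n := \col_i 'D_(e i) s u.
have rXi i : row i Xi = 'D_(e i) x u by apply/rowP => l; rewrite !mxE.
have sE i : sigma i 0 = 'D_(e i) s u by rewrite mxE.
have rJ i : row i ('J F u) =
    push a psi E alpha (s u) (x u) (row i Xi) (sigma i 0).
  by rewrite rowE -deriveEjacobian// derive_immersion// rXi sE.
have tg i : dot (x u) (row i Xi) = 0 by rewrite rXi sphere_tangent.
have Dx v : 'D_v x u = v *m Xi.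
  have dx := smooth_differentiable sx Uu.
  rewrite deriveEjacobian//; congr (_ *m _); apply/row_matrixP => i.
  by rewrite rowE -deriveEjacobian// rXi.
have Ds v : 'D_v s u = (v *m sigma) 0 0.
  have ds := smooth_differentiable ss Uu.
  rewrite deriveE// [in LHS](row_sum_delta v) linear_sum mxE.
  by apply: eq_bigr => i _; rewrite linearZ /= -deriveE// sE.
have rfree : row_free ('J F u).
  apply/inj_row_free => v; rewrite -deriveEjacobian// deriveE// => vF.
  by apply: (immersion_inj Uu); rewrite vF linear0.
have inj (v : 'rV[R]_n) : v *m Xi = 0 -> v *m sigma = 0 -> v = 0.
  move=> vX vs; apply: (immersion_inj Uu); rewrite linear0 -deriveE//.
  have vs0 : (v *m sigma) 0 0 = 0 by rewrite vs mxE.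
  rewrite derive_immersion// Dx Ds vX vs0.
  apply/rowP => j; rewrite [RHS]mxE; have [k ->|k ->] := split_ordP j.
    by rewrite row_mxEl !mxE mul0r !mulr0 addr0.
  by rewrite row_mxEr !mxE mul0r !mulr0 addr0.
have metricE : metric F u =
    gram Xi sigma (weights a (s u)) (axis_norm a E alpha (s u) (x u)).
  apply/matrixP => i j; rewrite mxE /partial !derive_immersion// -/(e i) -/(e j).
  rewrite dot_push ?sphere_tangent// mxE; congr (_ + _).
    rewrite mul_mx_diag mxE; apply: eq_bigr => l _.
    by rewrite !mxE mulrCA mulrA.
  by rewrite /axis_norm !mxE big_ord1 !mxE.
pose S i j := partial i (partial j F) u.
pose Gi := invmx (metric F u).
pose W := \sum_i \sum_j Gi i j *: S i j - alpha *: Lparam a psi E alpha (kappa u).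
suff W0 : normal_part ('J F u) W = 0.
  apply/eqP; rewrite -subr_eq0 -W0 /W normal_partB normal_partZ.
  rewrite normal_part_sum; apply/eqP; congr (_ - _); apply: eq_bigr => i _.
  by rewrite normal_part_sum; apply: eq_bigr => j _; rewrite normal_partZ.
(* [H - alpha * F^perp] is the normal part of [W], which is tangent because it is
   symplectically orthogonal to the tangent space. *)
apply/normal_part_tangent/lagrangian_maximal => // [i j|k].
  by rewrite !rowE -!deriveEjacobian// !deriveE// immersion_omega.
rewrite omegaBl omegaZl omega_suml rJ /Lparam Lpoint_push.
apply/eqP; rewrite subr_eq0; apply/eqP.
rewrite -(@trace_omega R n a psi E alpha ha (s u) (x u) Xi sigma s0 x1 tg inj
  (fun i j => 'D_(e i) ('D_(e j) x) u)
  (fun i j => 'D_(e i) ('D_(e j) s) u))//; last first.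
  by move=> i j; rewrite !rXi sphere_tangent2.
apply: eq_bigr => i _; rewrite omega_suml; apply: eq_bigr => j _.
rewrite omegaZl /Gi metricE; congr (_ * omega _ _).
by rewrite /S /partial derive2_immersion// !rXi !sE.
Qed.

End LocalCoordinates.

Lemma diffeomorphic_swap (R : realType) (n : nat) :
  diffeomorphic n (Ldomain R n) (nonzero R `*` sphere R n).
Proof.
have swapE : @swap R 'rV[R]_n R @` Ldomain R n = nonzero R `*` sphere R n.
  apply/seteqP; split=> [_ [[x s] [x1 s0] <-]//|[s x] [s0 x1]].
  by exists (x, s).
have sM := @submanifold_Ldomain R n.
split; [exact: sM|by rewrite -swapE; exact: submanifold_swap|].
exists (@swap R 'rV[R]_n R), (@swap R R 'rV[R]_n); split.
- exact: smooth_map_swap.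
- exact: smooth_map_swap.
- by move=> [x s] [].
- by move=> [s x] [].
Qed.

Unset Implicit Arguments.
Set Strict Implicit.

Theorem theorem1p3 (R : realType) (n : nat) (hn : (0 < n)%N)
    (a psi : 'I_n -> R) (E alpha : R)
    (ha : forall j, 0 < a j) (hE : 1 < E) (halpha : 0 <= alpha) :
  [/\ immersed_submanifold n (Ldomain R n) (Lparam a psi E alpha)
        (Lset a psi E alpha),
      lagrangian (Ldomain R n) (Lparam a psi E alpha),
      diffeomorphic n (Ldomain R n) (nonzero R `*` sphere R n)
    & forall (U : set 'rV[R]_n) (kappa : 'rV[R]_n -> 'rV[R]_n * R),
        local_param (Ldomain R n) U kappa ->
        forall u, U u ->
          mean_curvature (Lparam a psi E alpha \o kappa) u =
          alpha *: normal_part ('J (Lparam a psi E alpha \o kappa) u)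
                     (Lparam a psi E alpha (kappa u))].
Proof.
split.
- split; first exact: submanifold_Ldomain.
    split=> U kappa hk; first exact: (smooth_immersion psi ha hE halpha hk).
    by move=> u Uu; exact: (immersion_inj ha hE halpha hk Uu).
  apply/seteqP; split=> [z [x [s [x1 s0 ->]]]|_ [[x s] [x1 s0] <-]].
    by exists (x, s).
  by exists x, s.
- by move=> U kappa hk u Uu v w; exact: (immersion_omega psi ha hE halpha hk).
- exact: diffeomorphic_swap.
- move=> U kappa hk u Uu.
  exact: (mean_curvature_immersion psi ha hE halpha hk).
Qed.
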